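(* Let $W$ be a locally presentable category, let $U:V\to W$ be a monadic, accessible and coproduct-preserving functor with left adjoint denoted $F$, and let $(E,u,\sigma)$ be a closed normal multitensor on $V$. Then $$(UEF)'\cong E$$ as multitensors on $V\cong W^{(UEF)_1}=W^{UF}$.
   Context: A multitensor (lax monoidal structure) $(E,u,\sigma)$ on a category $V$ consists of functors $E_n:V^n\to V$ ($n\ge0$), written $(X_1,\dots,X_n)\mapsto \mathrm{E}_iX_i$, and natural maps $u_X:X\to E_1X$ and $\sigma:\mathrm{E}_i\mathrm{E}_jX_{ij}\to\mathrm{E}_{ij}X_{ij}$ (the codomain being $E$ applied to the concatenated sequence), satisfying the evident unit and associativity axioms. A morphism of multitensors is a family of natural transformations compatible with units and substitutions. $E_1$ is a monad on $V$. $E$ is normal if $E_1$ is the identity functor and $u$ is the identity; distributive if each $E_n$ preserves (small) coproducts in each variable; and, for $V$ locally presentable, closed if each $E_n$ preserves all colimits in each variable. An $E$-category is a $V$-graph $X$ (a set $X_0$ with objects $X(a,b)\in V$ for $a,b\in X_0$) with composition maps $\mathrm{E}_iX(x_{i-1},x_i)\to X(x_0,x_n)$ for all $n\ge0$ and $x_0,\dots,x_n\in X_0$, compatible with $u$ and $\sigma$. $E$-functors are $V$-graph morphisms preserving composition; $E\text{-}\mathbf{Cat}$ denotes the category of these. $\mathcal{G}V$ is the category of $V$-graphs. Here ''monadic'' means that the comparison functor $V\to W^{UF}$ is an isomorphism; ''accessible'' means preserving $\lambda$-filtered colimits for some regular cardinal $\lambda$. It follows that $V$ is locally presentable. The multitensor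 $UEF$ on $W$ has $(UEF)_n(X_1,\dots,X_n)=U\,\mathrm{E}_iFX_i$. Its unit is $X\to UFX\xrightarrow{Uu}UE_1FX$, and its substitution is $U\mathrm{E}_iFU\mathrm{E}_jFX_{ij}\to U\mathrm{E}_i\mathrm{E}_jFX_{ij}\to U\mathrm{E}_{ij}FX_{ij}$, using the counit of $F\dashv U$ and then $\sigma$. For $E$ normal, $(UEF)_1$ is the monad $UF$. In the situation of the statement $UEF$ is distributive. Lifting: let $D$ be a distributive multitensor, accessible in each variable, on a locally presentable category $W$. For every $D$-category $X$, the unary compositions $D_1X(a,b)\to X(a,b)$ make the homs $D_1$-algebras, giving a functor $D\text{-}\mathbf{Cat}\to\mathcal{G}(W^{D_1})$. It is a known theorem that there is, up to isomorphism, a unique normal distributive multitensor $D'$ on $W^{D_1}$ with an isomorphism $D'\text{-}\mathbf{Cat}\cong D\text{-}\mathbf{Cat}$ commuting with the functors to $\mathcal{G}(W^{D_1})$; $D'$ is called the lifted multitensor. *)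

(* Defs.v *)
From Stdlib Require Import FunctionalExtensionality ProofIrrelevance.
From mathcomp Require Import all_boot.

Set Implicit Arguments.
Unset Strict Implicit.
Unset Printing Implicit Defensive.

Declare Scope cat_scope.
Delimit Scope cat_scope with cat.
Local Open Scope cat_scope.
Local Obligation Tactic := idtac.

(** One fixed universe of small types ("sets"); homs are small, objects need
    not be.  Equality of objects, morphisms and functors is Leibniz equality. *)
Definition SmallType := Type.

Record isCategory (Ob : Type) := IsCategory {
  hom_ : Ob -> Ob -> SmallType;
  id_ : forall x, hom_ x x;
  comp_ : forall x y z, hom_ y z -> hom_ x y -> hom_ x z;
  comp_idl_ : forall x y (f : hom_ x y), comp_ (id_ y) f = f;
  comp_idr_ : forall x y (f : hom_ x y), comp_ f (id_ x) = f;
  comp_assoc_ : forall x y z w (h : hom_ z w) (g : hom_ y z) (f : hom_ x y),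
    comp_ h (comp_ g f) = comp_ (comp_ h g) f
}.

Record Category := MkCategory {
  Ob :> Type;
  cat_ax : isCategory Ob
}.

Record SmallCategory := MkSmallCategory {
  SOb : SmallType;
  scat_ax : isCategory SOb
}.

Coercion cat_of_small (J : SmallCategory) : Category :=
  MkCategory (scat_ax J).

Definition hom (C : Category) (x y : C) : SmallType := hom_ (cat_ax C) x y.
Definition idm (C : Category) (x : C) : hom x x := id_ (cat_ax C) x.
Definition compm (C : Category) (x y z : C) (g : hom y z) (f : hom x y) :
  hom x z := comp_ g f.
Arguments idm {C} x.

Notation "g ∘ f" := (compm g f) (at level 40, left associativity) : cat_scope.

Lemma comp_idl (C : Category) (x y : C) (f : hom x y) : idm y ∘ f = f.
Proof. exact: comp_idl_. Qed.

Lemma comp_idr (C : Category) (x y : C) (f : hom x y) : f ∘ idm x = f.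
Proof. exact: comp_idr_. Qed.

Lemma comp_assoc (C : Category) (x y z w : C)
    (h : hom z w) (g : hom y z) (f : hom x y) : h ∘ (g ∘ f) = h ∘ g ∘ f.
Proof. exact: comp_assoc_. Qed.

(** The identity, read as a morphism between two equal objects. *)
Definition eq_hom (C : Category) (x y : C) (p : x = y) : hom x y :=
  match p in _ = z return hom x z with erefl => idm x end.

Lemma eq_hom_id (C : Category) (x : C) (p : x = x) : eq_hom p = idm x.
Proof. by rewrite (proof_irrelevance _ p erefl). Qed.

Lemma eq_hom_comp (C : Category) (x y z : C) (p : x = y) (q : y = z) :
  eq_hom q ∘ eq_hom p = eq_hom (etrans p q).
Proof. by case: z / q; case: y / p; rewrite comp_idl. Qed.

Record Functor (C D : Category) := MkFunctor {
  fobj :> C -> D;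
  fmap : forall x y : C, hom x y -> hom (fobj x) (fobj y);
  fmap_id : forall x, fmap (idm x) = idm (fobj x);
  fmap_comp : forall (x y z : C) (g : hom y z) (f : hom x y),
    fmap (g ∘ f) = fmap g ∘ fmap f
}.
Arguments fmap {C D} _ {x y} _.

Lemma fmap_eq_hom (C D : Category) (F : Functor C D) (x y : C) (p : x = y)
    (q : F x = F y) : fmap F (eq_hom p) = eq_hom q.
Proof. by case: y / p q => q; rewrite fmap_id eq_hom_id. Qed.

Definition functor_id (C : Category) : Functor C C :=
  @MkFunctor C C id (fun _ _ => id) (fun _ => erefl) (fun _ _ _ _ _ => erefl).

Program Definition functor_comp (A B C : Category)
    (G : Functor B C) (F : Functor A B) : Functor A C :=
  {| fobj := fun x => G (F x); fmap := fun _ _ f => fmap G (fmap F f) |}.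
Next Obligation. by move=> * /=; rewrite !fmap_id. Qed.
Next Obligation. by move=> * /=; rewrite !fmap_comp. Qed.

Notation "G ⊚ F" := (functor_comp G F) (at level 40, left associativity)
  : cat_scope.

Record NatTrans (C D : Category) (F G : Functor C D) := MkNatTrans {
  nt :> forall x, hom (F x) (G x);
  nt_nat : forall (x y : C) (f : hom x y), nt y ∘ fmap F f = fmap G f ∘ nt x
}.

Program Definition nt_id (C D : Category) (F : Functor C D) : NatTrans F F :=
  {| nt := fun x => idm (F x) |}.
Next Obligation. by move=> * /=; rewrite comp_idl comp_idr. Qed.

Lemma functor_ext (C D : Category) (f : C -> D)
    (m m' : forall x y : C, hom x y -> hom (f x) (f y)) i i' c c' :
  (forall x y h, m x y h = m' x y h) ->
  @MkFunctor C D f m i c = @MkFunctor C D f m' i' c'.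
Proof.
move=> e; have e' : m = m'.
  by do 3![apply: functional_extensionality_dep => ?].
by subst m'; f_equal; apply: proof_irrelevance.
Qed.

Lemma nt_ext (C D : Category) (F G : Functor C D) (a b : NatTrans F G) :
  (forall x, a x = b x) -> a = b.
Proof.
case: a b => [a ha] [b hb] /= e.
have e' : a = b by apply: functional_extensionality_dep.
by subst b; f_equal; apply: proof_irrelevance.
Qed.

Record invertible (C D : Category) (K : Functor C D) := Invertible {
  inverse : Functor D C;
  inverseK : inverse ⊚ K = functor_id C;
  Kinverse : K ⊚ inverse = functor_id D
}.

Record CatIso (C D : Category) := MkCatIso {
  iso_fun :> Functor C D;
  iso_inv : invertible iso_fun
}.

Record Cocone (J C : Category) (D : Functor J C) := MkCocone {
  apex : C;
  leg : forall j, hom (D j) apex;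
  leg_nat : forall (i j : J) (f : hom i j), leg j ∘ fmap D f = leg i
}.

Definition is_colimit (J C : Category) (D : Functor J C) (c : Cocone D) :=
  forall c' : Cocone D,
    exists! h : hom (apex c) (apex c'), forall j, h ∘ leg c j = leg c' j.

Program Definition cocone_map (J C C' : Category) (G : Functor C C')
    (D : Functor J C) (c : Cocone D) : Cocone (G ⊚ D) :=
  {| apex := G (apex c); leg := fun j => fmap G (leg c j) |}.
Next Obligation. by move=> *; rewrite /= -fmap_comp leg_nat. Qed.

Definition preserves_colimit (J C C' : Category) (G : Functor C C')
    (D : Functor J C) :=
  forall c : Cocone D, is_colimit c -> is_colimit (cocone_map G c).

Definition preserves_colimits (C C' : Category) (G : Functor C C') :=
  forall (J : SmallCategory) (D : Functor J C), preserves_colimit G D.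

Definition discrete (I : SmallType) : SmallCategory :=
  @MkSmallCategory I (@IsCategory I (fun i j => i = j) (fun i => erefl i)
    (fun i j k q p => etrans p q)
    (fun _ _ _ => proof_irrelevance _ _ _)
    (fun _ _ _ => proof_irrelevance _ _ _)
    (fun _ _ _ _ _ _ _ => proof_irrelevance _ _ _)).

Definition preserves_coproducts (C C' : Category) (G : Functor C C') :=
  forall (I : SmallType) (D : Functor (discrete I) C), preserves_colimit G D.

Definition cocomplete (C : Category) :=
  forall (J : SmallCategory) (D : Functor J C),
    exists c : Cocone D, is_colimit c.

(** Cardinals are represented by small types. *)
Definition card_le (A B : SmallType) : Prop :=
  exists f : A -> B, injective f.

Definition card_lt (A B : SmallType) : Prop := card_le A B /\ ~ card_le B A.

Definition regular_cardinal (L : SmallType) : Prop :=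
  card_le nat L /\
  forall (I : SmallType) (A : I -> SmallType),
    card_lt I L -> (forall i, card_lt (A i) L) -> card_lt {i : I & A i} L.

Definition filtered (L : SmallType) (J : SmallCategory) : Prop :=
  forall A : SmallCategory,
    card_lt {a : SOb A & {b : SOb A & hom_ (scat_ax A) a b}} L ->
    forall D : Functor A J, inhabited (Cocone D).

Definition preserves_filtered_colimits (L : SmallType) (C C' : Category)
    (G : Functor C C') :=
  forall J : SmallCategory, filtered L J ->
    forall D : Functor J C, preserves_colimit G D.

Definition accessible (C C' : Category) (G : Functor C C') :=
  exists L : SmallType,
    regular_cardinal L /\ preserves_filtered_colimits L G.

Definition Sets : Category :=
  @MkCategory SmallType (@IsCategory SmallType (fun A B => A -> B)
    (fun _ => id) (fun _ _ _ g f x => g (f x))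
    (fun _ _ _ => erefl) (fun _ _ _ => erefl) (fun _ _ _ _ _ _ _ => erefl)).

Program Definition hom_functor (C : Category) (p : C) : Functor C Sets :=
  {| fobj := fun x => hom p x : Sets; fmap := fun _ _ f g => f ∘ g |}.
Next Obligation.
by move=> C p x; apply: functional_extensionality => g; apply: comp_idl.
Qed.
Next Obligation.
by move=> C p x y z g f; apply: functional_extensionality => h /=;
  rewrite -comp_assoc.
Qed.

Definition presentable (L : SmallType) (C : Category) (p : C) :=
  preserves_filtered_colimits L (hom_functor p).

Definition locally_presentable (C : Category) : Prop :=
  cocomplete C /\
  exists L : SmallType, regular_cardinal L /\
  exists (I : SmallType) (G : I -> C),
    (forall i, presentable L (G i)) /\
    forall x : C, exists (J : SmallCategory) (D : Functor J C) (c : Cocone D),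
      [/\ filtered L J, is_colimit c, apex c = x
        & forall j, exists i, D j = G i].

Record Adjunction (C D : Category) (F : Functor D C) (U : Functor C D) :=
  MkAdjunction {
  adj_unit : NatTrans (functor_id D) (U ⊚ F);
  adj_counit : NatTrans (F ⊚ U) (functor_id C);
  adj_triangleF : forall d, adj_counit (F d) ∘ fmap F (adj_unit d) = idm (F d);
  adj_triangleU : forall c, fmap U (adj_counit c) ∘ adj_unit (U c) = idm (U c)
}.

Record Monad (C : Category) := MkMonad {
  mnd :> Functor C C;
  mnd_eta : NatTrans (functor_id C) mnd;
  mnd_mu : NatTrans (mnd ⊚ mnd) mnd;
  mnd_unitl : forall x, mnd_mu x ∘ mnd_eta (mnd x) = idm (mnd x);
  mnd_unitr : forall x, mnd_mu x ∘ fmap mnd (mnd_eta x) = idm (mnd x);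
  mnd_assoc : forall x,
    mnd_mu x ∘ fmap mnd (mnd_mu x) = mnd_mu x ∘ mnd_mu (mnd x)
}.

Program Definition adj_monad (C D : Category) (F : Functor D C)
    (U : Functor C D) (adj : Adjunction F U) : Monad D :=
  {| mnd := U ⊚ F;
     mnd_eta := adj_unit adj;
     mnd_mu := {| nt := fun x => fmap U (adj_counit adj (F x)) |} |}.
Next Obligation.
move=> C D F U adj x y f /=; rewrite -!fmap_comp; congr fmap.
exact: (nt_nat (adj_counit adj)).
Qed.
Next Obligation. by move=> C D F U adj x /=; rewrite adj_triangleU. Qed.
Next Obligation.
by move=> C D F U adj x /=; rewrite -fmap_comp adj_triangleF fmap_id.
Qed.
Next Obligation.
move=> C D F U adj x /=; rewrite -!fmap_comp; congr fmap.
exact: (nt_nat (adj_counit adj) (adj_counit adj (F x))).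
Qed.

Record Algebra (C : Category) (T : Monad C) := MkAlgebra {
  alg_ob : C;
  alg_act : hom (T alg_ob) alg_ob;
  alg_unit : alg_act ∘ mnd_eta T alg_ob = idm alg_ob;
  alg_assoc : alg_act ∘ fmap T alg_act = alg_act ∘ mnd_mu T alg_ob
}.

Record AlgHom (C : Category) (T : Monad C) (a b : Algebra T) := MkAlgHom {
  alg_hom : hom (alg_ob a) (alg_ob b);
  alg_homP : alg_hom ∘ alg_act a = alg_act b ∘ fmap T alg_hom
}.

Lemma alg_hom_ext (C : Category) (T : Monad C) (a b : Algebra T)
    (f g : AlgHom a b) : alg_hom f = alg_hom g -> f = g.
Proof.
case: f g => [f hf] [g hg] /= e; subst g.
by f_equal; apply: proof_irrelevance.
Qed.

Program Definition EM (C : Category) (T : Monad C) : Category :=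
  @MkCategory (Algebra T) (@IsCategory (Algebra T) (@AlgHom C T)
    (fun a => {| alg_hom := idm (alg_ob a) |})
    (fun a b c g f => {| alg_hom := alg_hom g ∘ alg_hom f |}) _ _ _).
Next Obligation. by move=> C T a; rewrite comp_idl fmap_id comp_idr. Qed.
Next Obligation.
move=> C T a b c g f.
by rewrite fmap_comp -comp_assoc alg_homP !comp_assoc alg_homP.
Qed.
Next Obligation. by move=> *; apply: alg_hom_ext; apply: comp_idl. Qed.
Next Obligation. by move=> *; apply: alg_hom_ext; apply: comp_idr. Qed.
Next Obligation. by move=> *; apply: alg_hom_ext; apply: comp_assoc. Qed.

Program Definition comparison (C D : Category) (F : Functor D C)
    (U : Functor C D) (adj : Adjunction F U) :
    Functor C (EM (adj_monad adj)) :=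
  @MkFunctor C (EM (adj_monad adj))
    (fun c => @MkAlgebra D (adj_monad adj) (U c) (fmap U (adj_counit adj c)) _ _)
    (fun x y f => @MkAlgHom D (adj_monad adj) _ _ (fmap U f) _) _ _.
Next Obligation. by move=> *; rewrite /= adj_triangleU. Qed.
Next Obligation.
move=> C D F U adj c /=; rewrite -!fmap_comp; congr fmap.
exact: (nt_nat (adj_counit adj) (adj_counit adj c)).
Qed.
Next Obligation.
move=> C D F U adj x y f /=; rewrite -!fmap_comp; congr fmap.
exact/esym/(nt_nat (adj_counit adj)).
Qed.
Next Obligation. by move=> *; apply: alg_hom_ext; apply: fmap_id. Qed.
Next Obligation. by move=> *; apply: alg_hom_ext; apply: fmap_comp. Qed.

Definition monadic (C D : Category) (F : Functor D C) (U : Functor C D)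
  (adj : Adjunction F U) := invertible (comparison adj).

(** [SeqCat C], the category of finite sequences, is the disjoint union of the
    powers [C^n]; a functor [SeqCat C -> D] is a family of functors
    [C^n -> D], [n >= 0]. *)

Section Sequences.
Variable C : Category.
Implicit Types xs ys zs : seq C.

Fixpoint lhom xs ys : SmallType :=
  match xs, ys with
  | [::], [::] => unit
  | x :: xs', y :: ys' => (hom x y * lhom xs' ys')%type
  | _, _ => Empty_set
  end.

Fixpoint lid xs : lhom xs xs :=
  match xs with
  | [::] => tt
  | x :: xs' => (idm x, lid xs')
  end.

Fixpoint lcomp xs ys zs : lhom ys zs -> lhom xs ys -> lhom xs zs :=
  match xs, ys, zs return lhom ys zs -> lhom xs ys -> lhom xs zs with
  | [::], [::], _ => fun g _ => g
  | _ :: xs', _ :: ys', _ :: zs' => fun g f =>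
      (g.1 ∘ f.1, @lcomp xs' ys' zs' g.2 f.2)
  | _ :: _, _ :: _, [::] => fun g _ => match g with end
  | [::], _ :: _, _ => fun _ f => match f with end
  | _ :: _, [::], _ => fun _ f => match f with end
  end.

Lemma lcomp_idl xs ys (f : lhom xs ys) : lcomp (lid ys) f = f.
Proof.
elim: xs ys f => [|x xs IH] [|y ys] //=; first by case.
by case=> f fs /=; rewrite IH comp_idl.
Qed.

Lemma lcomp_idr xs ys (f : lhom xs ys) : lcomp f (lid xs) = f.
Proof.
elim: xs ys f => [|x xs IH] [|y ys] //=.
by case=> f fs /=; rewrite IH comp_idr.
Qed.

Lemma lcomp_assoc xs ys zs ws (h : lhom zs ws) (g : lhom ys zs)
    (f : lhom xs ys) : lcomp h (lcomp g f) = lcomp (lcomp h g) f.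
Proof.
elim: xs ys zs ws f g h => [|x xs IH] [|y ys] [|z zs] [|w ws] //=;
  try by move=> ? ? [].
all: try by move=> ? [].
all: try by case.
by move=> f g h; rewrite IH comp_assoc.
Qed.

Definition SeqCat : Category :=
  @MkCategory (seq C) (@IsCategory (seq C) lhom lid lcomp
    lcomp_idl lcomp_idr lcomp_assoc).

Fixpoint lcat xs ys xs' ys' : lhom xs ys -> lhom xs' ys' ->
    lhom (xs ++ xs') (ys ++ ys') :=
  match xs, ys return lhom xs ys -> lhom xs' ys' ->
    lhom (xs ++ xs') (ys ++ ys') with
  | [::], [::] => fun _ f' => f'
  | _ :: xs1, _ :: ys1 => fun f f' => (f.1, @lcat xs1 ys1 xs' ys' f.2 f')
  | [::], _ :: _ => fun f _ => match f with end
  | _ :: _, [::] => fun f _ => match f with end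
  end.

Lemma lcat_id xs ys : lcat (lid xs) (lid ys) = lid (xs ++ ys).
Proof. by elim: xs => //= x xs ->. Qed.

Lemma lcat_comp xs ys zs xs' ys' zs' (g : lhom ys zs) (f : lhom xs ys)
    (g' : lhom ys' zs') (f' : lhom xs' ys') :
  lcat (lcomp g f) (lcomp g' f') = lcomp (lcat g g') (lcat f f').
Proof.
elim: xs ys zs f g => [|x xs IH] [|y ys] [|z zs] //=.
all: try by move=> ? [].
all: try by case.
by move=> [f fs] [g gs] /=; rewrite IH.
Qed.

Program Definition singleton : Functor C SeqCat :=
  @MkFunctor C SeqCat (fun x => [:: x]) (fun _ _ f => (f, tt)) _ _.
Next Obligation. by []. Qed.
Next Obligation. by []. Qed.

(** [x |-> (l, x, r)]; precomposing with it fixes all variables but one. *)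
Program Definition slot (l r : seq C) : Functor C SeqCat :=
  @MkFunctor C SeqCat (fun x => l ++ x :: r)
    (fun x y f => @lcat l l (x :: r) (y :: r) (lid l) (f, lid r)) _ _.
Next Obligation. by move=> l r x; apply: (lcat_id l (x :: r)). Qed.
Next Obligation.
move=> l r x y z g f; rewrite /compm /= -lcat_comp /=.
by rewrite (lcomp_idl (lid l)) (lcomp_idl (lid r)).
Qed.

End Sequences.

Definition lcast (C : Category) (xs ys : seq C) (p : xs = ys) : lhom xs ys :=
  @eq_hom (SeqCat C) xs ys p.

Definition lfmap (C D : Category) (G : Functor (SeqCat C) D) (xs ys : seq C)
    (f : lhom xs ys) : hom (G xs) (G ys) :=
  @fmap (SeqCat C) D G xs ys f.

Lemma lcast_id (C : Category) (xs : seq C) (p : xs = xs) : lcast p = lid xs.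
Proof. exact: (@eq_hom_id (SeqCat C)). Qed.

Lemma lcast_comp (C : Category) (xs ys zs : seq C) (p : xs = ys) (q : ys = zs) :
  lcomp (lcast q) (lcast p) = lcast (etrans p q).
Proof. exact: (@eq_hom_comp (SeqCat C)). Qed.

Lemma lcast_cons (C : Category) (x y : C) (xs ys : seq C)
    (p : x :: xs = y :: ys) (q : x = y) (r : xs = ys) :
  lcast p = (eq_hom q, lcast r).
Proof. by subst y ys; rewrite !lcast_id eq_hom_id. Qed.

Lemma lcast_cat (C : Category) (xs xs' ys ys' : seq C)
    (p : xs ++ xs' = ys ++ ys') (q : xs = ys) (r : xs' = ys') :
  lcast p = lcat (lcast q) (lcast r).
Proof. by subst ys ys'; rewrite !lcast_id lcat_id. Qed.

Lemma lfmap_id (C D : Category) (G : Functor (SeqCat C) D) (xs : seq C) :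
  lfmap G (lid xs) = idm (G xs).
Proof. exact: (@fmap_id (SeqCat C)). Qed.

Lemma lfmap_comp (C D : Category) (G : Functor (SeqCat C) D)
    (xs ys zs : seq C) (g : lhom ys zs) (f : lhom xs ys) :
  lfmap G (lcomp g f) = lfmap G g ∘ lfmap G f.
Proof. exact: (@fmap_comp (SeqCat C)). Qed.

Section MapFunctor.
Variables (C D : Category) (F : Functor C D).

Fixpoint lmap (xs ys : seq C) : lhom xs ys -> lhom (map F xs) (map F ys) :=
  match xs, ys return lhom xs ys -> lhom (map F xs) (map F ys) with
  | [::], [::] => fun f => f
  | _ :: xs', _ :: ys' => fun f => (fmap F f.1, @lmap xs' ys' f.2)
  | [::], _ :: _ => fun f => match f with end
  | _ :: _, [::] => fun f => match f with end
  end.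

Lemma lmap_id xs : lmap (lid xs) = lid (map F xs).
Proof. by elim: xs => //= x xs ->; rewrite fmap_id. Qed.

Lemma lmap_comp xs ys zs (g : lhom ys zs) (f : lhom xs ys) :
  lmap (lcomp g f) = lcomp (lmap g) (lmap f).
Proof.
elim: xs ys zs f g => [|x xs IH] [|y ys] [|z zs] //=.
all: try by move=> ? [].
all: try by case.
by move=> [f fs] [g gs] /=; rewrite IH fmap_comp.
Qed.

Definition SeqFun : Functor (SeqCat C) (SeqCat D) :=
  @MkFunctor (SeqCat C) (SeqCat D) (map F) lmap lmap_id lmap_comp.

End MapFunctor.

Section Flatten.
Variable C : Category.

Fixpoint lflatten (xs ys : seq (seq C)) :
    @lhom (SeqCat C) xs ys -> lhom (flatten xs) (flatten ys) :=
  match xs, ys return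
    @lhom (SeqCat C) xs ys -> lhom (flatten xs) (flatten ys) with
  | [::], [::] => fun f => f
  | _ :: xs', _ :: ys' => fun f => lcat f.1 (@lflatten xs' ys' f.2)
  | [::], _ :: _ => fun f => match f with end
  | _ :: _, [::] => fun f => match f with end
  end.

Lemma lflatten_id xs : lflatten (@lid (SeqCat C) xs) = lid (flatten xs).
Proof. by elim: xs => //= x xs ->; apply: lcat_id. Qed.

Lemma lflatten_comp xs ys zs (g : @lhom (SeqCat C) ys zs)
    (f : @lhom (SeqCat C) xs ys) :
  lflatten (lcomp g f) = lcomp (lflatten g) (lflatten f).
Proof.
elim: xs ys zs f g => [|x xs IH] [|y ys] [|z zs] //=.
all: try by move=> ? [].
all: try by case.
by move=> [f fs] [g gs] /=; rewrite IH; apply: lcat_comp.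
Qed.

Definition flatten_functor : Functor (SeqCat (SeqCat C)) (SeqCat C) :=
  @MkFunctor (SeqCat (SeqCat C)) (SeqCat C) flatten lflatten
    lflatten_id lflatten_comp.

End Flatten.

Lemma flatten1 (T : Type) (s : seq T) : flatten [:: s] = s.
Proof. exact: cats0. Qed.

Lemma flatten_singletons (T : Type) (s : seq T) :
  flatten (map (fun x => [:: x]) s) = s.
Proof. by elim: s => //= x s ->. Qed.

Lemma flatten_map_map (S T : Type) (f : S -> T) (ss : seq (seq S)) :
  flatten (map (map f) ss) = map f (flatten ss).
Proof. by elim: ss => //= s ss ->; rewrite map_cat. Qed.

Lemma flatten_flatten (T : Type) (ss : seq (seq (seq T))) :
  flatten (flatten ss) = flatten (map flatten ss).
Proof. by elim: ss => //= s ss <-; rewrite flatten_cat. Qed.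

Fixpoint lunits (V : Category) (E : Functor (SeqCat V) V)
    (u : forall x : V, hom x (E [:: x])) (xs : seq V) :
    lhom xs (map E (map (fun x => [:: x]) xs)) :=
  match xs with
  | [::] => tt
  | x :: xs' => (u x, lunits u xs')
  end.

Fixpoint lsubs (V : Category) (E : Functor (SeqCat V) V)
    (sigma : forall xss : seq (seq V), hom (E (map E xss)) (E (flatten xss)))
    (xsss : seq (seq (seq V))) :
    lhom (map E (map (map E) xsss)) (map E (map flatten xsss)) :=
  match xsss with
  | [::] => tt
  | xss :: xsss' => (sigma xss, lsubs sigma xsss')
  end.

(** All casts are along equalities of sequences (or of endpoints of paths,
    below), which hold only propositionally for [flatten], [map] and [last]. *)
Record Multitensor (V : Category) := MkMultitensor {
  mt :> Functor (SeqCat V) V;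
  mt_unit : NatTrans (functor_id V) (mt ⊚ singleton V);
  mt_sub : NatTrans (mt ⊚ SeqFun mt) (mt ⊚ flatten_functor V);
  mt_unitl : forall xs : seq V,
    mt_sub [:: xs] ∘ mt_unit (mt xs) =
    lfmap mt (lcast (esym (flatten1 xs)));
  mt_unitr : forall xs : seq V,
    mt_sub (map (fun x => [:: x]) xs) ∘
      lfmap mt (lunits mt_unit xs) =
    lfmap mt (lcast (esym (flatten_singletons xs)));
  mt_assoc : forall xsss : seq (seq (seq V)),
    mt_sub (map flatten xsss) ∘
      lfmap mt (lsubs mt_sub xsss) =
    lfmap mt (lcast (flatten_flatten xsss)) ∘
      mt_sub (flatten xsss) ∘
      lfmap mt (lcast (flatten_map_map mt xsss)) ∘
      mt_sub (map (map mt) xsss)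
}.

Definition mt_distributive (V : Category) (E : Multitensor V) :=
  forall l r : seq V, preserves_coproducts (E ⊚ slot l r).

Definition mt_closed (V : Category) (E : Multitensor V) :=
  forall l r : seq V, preserves_colimits (E ⊚ slot l r).

(** [E_1 = id] as functors and, along that equality, [u = id]. *)
Definition mt_normal (V : Category) (E : Multitensor V) :=
  existT (fun T : Functor V V => NatTrans (functor_id V) T)
    (E ⊚ singleton V) (mt_unit E) =
  existT _ (functor_id V) (nt_id (functor_id V)).

Fixpoint lnats (V : Category) (E E' : Functor (SeqCat V) V)
    (phi : forall xs : seq V, hom (E xs) (E' xs)) (xss : seq (seq V)) :
    lhom (map E xss) (map E' xss) :=
  match xss with
  | [::] => tt
  | xs :: xss' => (phi xs, lnats phi xss')
  end.

Record MultitensorHom (V : Category) (E E' : Multitensor V) :=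
  MkMultitensorHom {
  mth :> NatTrans E E';
  mth_unit : forall x : V, mth [:: x] ∘ mt_unit E x = mt_unit E' x;
  mth_sub : forall xss : seq (seq V),
    mth (flatten xss) ∘ mt_sub E xss =
    mt_sub E' xss ∘ lfmap E' (lnats mth xss) ∘
      mth (map E xss)
}.

Definition multitensor_iso (V : Category) (E E' : Multitensor V) : Prop :=
  exists (f : MultitensorHom E E') (g : MultitensorHom E' E),
    forall xs : seq V, g xs ∘ f xs = idm (E xs) /\ f xs ∘ g xs = idm (E' xs).

Program Definition mt_monad (V : Category) (E : Multitensor V) : Monad V :=
  {| mnd := E ⊚ singleton V;
     mnd_eta := mt_unit E;
     mnd_mu := {| nt := fun x => mt_sub E [:: [:: x]] |} |}.
Next Obligation.
move=> V E x y f.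
exact: (@nt_nat _ _ _ _ (mt_sub E) [:: [:: x]] [:: [:: y]] ((f, tt), tt)).
Qed.
Next Obligation.
by move=> V E x; rewrite [LHS]mt_unitl lcast_id lfmap_id.
Qed.
Next Obligation.
by move=> V E x; rewrite [LHS](mt_unitr E [:: x]) lcast_id lfmap_id.
Qed.
Next Obligation.
move=> V E x; rewrite [LHS](mt_assoc E [:: [:: [:: x]]]) !lcast_id !lfmap_id.
by rewrite comp_idl comp_idr.
Qed.

Lemma lcat_map (C D : Category) (G : Functor C D) (xs ys xs' ys' : seq C)
    (f : lhom xs ys) (g : lhom xs' ys')
    (p : map G ys ++ map G ys' = map G (ys ++ ys'))
    (q : map G xs ++ map G xs' = map G (xs ++ xs')) :
  lcomp (lcast p) (lcat (lmap G f) (lmap G g)) =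
  lcomp (lmap G (lcat f g)) (lcast q).
Proof.
elim: xs ys f p q => [|x xs IH] [|y ys] f p q //=; try by case: f.
  by rewrite !lcast_id lcomp_idl lcomp_idr.
case: f => f fs.
have p' : map G ys ++ map G ys' = map G (ys ++ ys') by rewrite map_cat.
have q' : map G xs ++ map G xs' = map G (xs ++ xs') by rewrite map_cat.
rewrite (lcast_cons p erefl p') (lcast_cons q erefl q') /=.
by rewrite (IH _ _ p' q') comp_idl comp_idr.
Qed.

Definition lmap2 (C D : Category) (G : Functor C D) (xss yss : seq (seq C))
    (h : @lhom (SeqCat C) xss yss) :
    @lhom (SeqCat D) (map (map G) xss) (map (map G) yss) :=
  lmap (SeqFun G) h.

Lemma lflatten_map (C D : Category) (G : Functor C D) (xss yss : seq (seq C))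
    (h : @lhom (SeqCat C) xss yss)
    (p : flatten (map (map G) yss) = map G (flatten yss))
    (q : flatten (map (map G) xss) = map G (flatten xss)) :
  lcomp (lcast p) (lflatten (lmap2 G h)) =
  lcomp (lmap G (lflatten h)) (lcast q).
Proof.
elim: xss yss h p q => [|xs xss IH] [|ys yss] h p q //=; try by case: h.
  by case: h; rewrite lcast_id.
case: h => h hs /=.
have p1 : map G ys ++ flatten (map (map G) yss) =
          map G ys ++ map G (flatten yss) by rewrite flatten_map_map.
have p2 : map G ys ++ map G (flatten yss) = map G (ys ++ flatten yss)
  by rewrite map_cat.
have q1 : map G xs ++ flatten (map (map G) xss) =
          map G xs ++ map G (flatten xss) by rewrite flatten_map_map.
have q2 : map G xs ++ map G (flatten xss) = map G (xs ++ flatten xss)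
  by rewrite map_cat.
rewrite (proof_irrelevance _ p (etrans p1 p2)).
rewrite (proof_irrelevance _ q (etrans q1 q2)).
rewrite -!lcast_comp -lcomp_assoc.
rewrite (lcast_cat p1 erefl (flatten_map_map _ _)).
rewrite (lcast_cat q1 erefl (flatten_map_map _ _)) !lcast_id.
rewrite -lcat_comp (IH _ _ _ (flatten_map_map G xss)) (lcomp_idl (lmap G h)).
rewrite (lcomp_assoc (lmap G (lcat h (lflatten hs)))) -(lcat_map _ _ p2).
by rewrite -lcomp_assoc -lcat_comp (lcomp_idr (lmap G h)).
Qed.

Definition msub (V : Category) (E : Multitensor V) (xss : seq (seq V)) :
    hom (E (map E xss)) (E (flatten xss)) := mt_sub E xss.

Lemma msub_nat (V : Category) (E : Multitensor V) (xss yss : seq (seq V))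
    (h : @lhom (SeqCat V) xss yss) :
  msub E yss ∘ lfmap E (lmap E h) = lfmap E (lflatten h) ∘ msub E xss.
Proof. exact: (@nt_nat _ _ _ _ (mt_sub E) xss yss h). Qed.

Lemma lmap_cast (C D : Category) (G : Functor C D) (xs ys : seq C)
    (p : xs = ys) (q : map G xs = map G ys) : lmap G (lcast p) = lcast q.
Proof. by subst ys; rewrite !lcast_id lmap_id. Qed.

Lemma lfmap_cast (C D : Category) (G : Functor (SeqCat C) D) (xs ys : seq C)
    (p : xs = ys) (q : G xs = G ys) : lfmap G (lcast p) = eq_hom q.
Proof. by subst ys; rewrite lcast_id eq_hom_id lfmap_id. Qed.

Lemma msub_cast (V : Category) (E : Multitensor V) (xss yss : seq (seq V))
    (e : xss = yss) (p : map E xss = map E yss) (q : flatten xss = flatten yss) :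
  msub E yss ∘ lfmap E (lcast p) = lfmap E (lcast q) ∘ msub E xss.
Proof. by subst yss; rewrite !lcast_id !lfmap_id comp_idl comp_idr. Qed.

Lemma msub_assoc (V : Category) (E : Multitensor V) (xsss : seq (seq (seq V))) :
  msub E (map flatten xsss) ∘ lfmap E (lsubs (msub E) xsss) =
  lfmap E (lcast (flatten_flatten xsss)) ∘ msub E (flatten xsss) ∘
  lfmap E (lcast (flatten_map_map E xsss)) ∘ msub E (map (map E) xsss).
Proof. exact: mt_assoc. Qed.

Section UEF.
Variables (V W : Category) (F : Functor W V) (U : Functor V W).
Variables (adj : Adjunction F U) (E : Multitensor V).

Let UEFf : Functor (SeqCat W) W := U ⊚ E ⊚ SeqFun F.

Fixpoint lcounits (xss : seq (seq W)) :
    lhom (map F (map UEFf xss)) (map E (map (map F) xss)) :=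
  match xss with
  | [::] => tt
  | xs :: xss' => (adj_counit adj (E (map F xs)), lcounits xss')
  end.

Definition UEF_sub_E (xss : seq (seq W)) :
    hom (E (map F (map UEFf xss))) (E (map F (flatten xss))) :=
  lfmap E (lcast (flatten_map_map F xss)) ∘ msub E (map (map F) xss) ∘
    lfmap E (lcounits xss).

Lemma lcounits_nat xss yss (h : @lhom (SeqCat W) xss yss) :
  lcomp (lcounits yss) (lmap F (lmap UEFf h)) =
  lcomp (lmap E (lmap2 F h)) (lcounits xss).
Proof.
elim: xss yss h => [|xs xss IH] [|ys yss] //=; first by case.
case=> h hs /=; rewrite IH; congr pair.
exact: (nt_nat (adj_counit adj) (fmap E (lmap F h))).
Qed.

Lemma UEF_sub_nat xss yss (h : @lhom (SeqCat W) xss yss) :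
  UEF_sub_E yss ∘ lfmap E (lmap F (lmap UEFf h)) =
  lfmap E (lmap F (lflatten h)) ∘ UEF_sub_E xss.
Proof.
rewrite /UEF_sub_E -comp_assoc -lfmap_comp lcounits_nat lfmap_comp.
rewrite comp_assoc -(comp_assoc _ (msub E _)) msub_nat !comp_assoc.
congr (_ ∘ _ ∘ _); rewrite -!lfmap_comp; congr (lfmap E _).
exact: lflatten_map.
Qed.

Lemma lcounits_cat xss yss
    (p : map F (map UEFf xss) ++ map F (map UEFf yss) =
         map F (map UEFf (xss ++ yss)))
    (q : map E (map (map F) xss) ++ map E (map (map F) yss) =
         map E (map (map F) (xss ++ yss))) :
  lcomp (lcounits (xss ++ yss)) (lcast p) =
  lcomp (lcast q) (lcat (lcounits xss) (lcounits yss)).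
Proof.
elim: xss p q => [|xs xss IH] p q //=.
  by rewrite !lcast_id lcomp_idl lcomp_idr.
have p' : map F (map UEFf xss) ++ map F (map UEFf yss) =
         map F (map UEFf (xss ++ yss)) by rewrite !map_cat.
have q' : map E (map (map F) xss) ++ map E (map (map F) yss) =
         map E (map (map F) (xss ++ yss)) by rewrite !map_cat.
rewrite (lcast_cons p erefl p') (lcast_cons q erefl q') /=.
by rewrite (IH p' q') comp_idl comp_idr.
Qed.

Fixpoint lcounits2 (xsss : seq (seq (seq W))) :
    @lhom (SeqCat V) (map (map F) (map (map UEFf) xsss))
      (map (map E) (map (map (map F)) xsss)) :=
  match xsss with
  | [::] => tt
  | xss :: xsss' => (lcounits xss, lcounits2 xsss')
  end.

Lemma lcounits_flatten xsss
    (p : flatten (map (map F) (map (map UEFf) xsss)) =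
         map F (map UEFf (flatten xsss)))
    (q : flatten (map (map E) (map (map (map F)) xsss)) =
         map E (map (map F) (flatten xsss))) :
  lcomp (lcounits (flatten xsss)) (lcast p) =
  lcomp (lcast q) (lflatten (lcounits2 xsss)).
Proof.
elim: xsss p q => [|xss xsss IH] p q //=; first by rewrite lcast_id.
have p' : flatten (map (map F) (map (map UEFf) xsss)) =
         map F (map UEFf (flatten xsss)) by rewrite !flatten_map_map.
have q' : flatten (map (map E) (map (map (map F)) xsss)) =
         map E (map (map F) (flatten xsss)) by rewrite !flatten_map_map.
have p1 : map F (map UEFf xss) ++ flatten (map (map F) (map (map UEFf) xsss)) =
   map F (map UEFf xss) ++ map F (map UEFf (flatten xsss)) by rewrite p'.
have p2 : map F (map UEFf xss) ++ map F (map UEFf (flatten xsss)) =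
   map F (map UEFf (xss ++ flatten xsss)) by rewrite !map_cat.
have q1 : map E (map (map F) xss) ++
     flatten (map (map E) (map (map (map F)) xsss)) =
   map E (map (map F) xss) ++ map E (map (map F) (flatten xsss)) by rewrite q'.
have q2 : map E (map (map F) xss) ++ map E (map (map F) (flatten xsss)) =
   map E (map (map F) (xss ++ flatten xsss)) by rewrite !map_cat.
rewrite (proof_irrelevance _ p (etrans p1 p2)).
rewrite (proof_irrelevance _ q (etrans q1 q2)).
rewrite -!lcast_comp lcomp_assoc (lcounits_cat p2 q2) -!lcomp_assoc.
rewrite (lcast_cat p1 erefl p') (lcast_cat q1 erefl q') !lcast_id.
by rewrite -!lcat_comp (IH p' q') (lcomp_idl (lcounits xss)) lcomp_idr.
Qed.

Definition UEF_sub_ (xss : seq (seq W)) :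
    hom (UEFf (map UEFf xss)) (UEFf (flatten xss)) :=
  fmap U (UEF_sub_E xss).

Definition UEF_unit_ (x : W) : hom x (UEFf [:: x]) :=
  fmap U (mt_unit E (F x)) ∘ adj_unit adj x.

Lemma lfmap_UEFf (xs ys : seq W) (h : lhom xs ys) :
  lfmap UEFf h = fmap U (lfmap E (lmap F h)).
Proof. by []. Qed.

Lemma UEF_unit_nat x y (f : hom x y) :
  UEF_unit_ y ∘ f = @lfmap _ _ UEFf [:: x] [:: y] (f, tt) ∘ UEF_unit_ x.
Proof.
rewrite /UEF_unit_ -comp_assoc [adj_unit adj y ∘ f](nt_nat (adj_unit adj)) /=.
rewrite !comp_assoc -fmap_comp; congr (_ ∘ _).
rewrite [mt_unit E _ ∘ _](nt_nat (mt_unit E)) fmap_comp.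
by [].
Qed.

Lemma UEF_unitl (xs : seq W) :
  UEF_sub_ [:: xs] ∘ UEF_unit_ (UEFf xs) =
  lfmap UEFf (lcast (esym (flatten1 xs))).
Proof.
have pF : map F xs = map F (flatten [:: xs]) by rewrite flatten1.
rewrite /UEF_sub_ /UEF_unit_ /UEF_sub_E comp_assoc -fmap_comp /=.
have -> : lfmap E (lcast (flatten_map_map F [:: xs])) ∘
    msub E [:: map F xs] ∘
    @lfmap _ _ E [:: _] [:: _] (adj_counit adj (E (map F xs)), tt) ∘
    mt_unit E (F (UEFf xs)) =
    lfmap E (lcast pF) ∘ adj_counit adj (E (map F xs)).
  rewrite -[LHS]comp_assoc.
  have -> : @lfmap _ _ E [:: _] [:: _] (adj_counit adj (E (map F xs)), tt) ∘
     mt_unit E (F (UEFf xs)) =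
     mt_unit E (E (map F xs)) ∘ adj_counit adj (E (map F xs)).
    exact/esym/(nt_nat (mt_unit E)).
  rewrite comp_assoc; congr (_ ∘ _); rewrite -comp_assoc.
  rewrite [msub E _ ∘ _](mt_unitl E (map F xs)) -lfmap_comp lcast_comp.
  by congr (lfmap E (lcast _)); apply: proof_irrelevance.
rewrite fmap_comp -comp_assoc adj_triangleU comp_idr.
by rewrite -(lmap_cast (esym (flatten1 xs)) pF).
Qed.

Lemma lcounits_units (xs : seq W)
    (p : map E (map (fun x => [:: x]) (map F xs)) =
         map E (map (map F) (map (fun x => [:: x]) xs))) :
  lcomp (lcounits (map (fun x => [:: x]) xs)) (lmap F (lunits UEF_unit_ xs)) =
  lcomp (lcast p) (lunits (mt_unit E) (map F xs)).
Proof.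
elim: xs p => [|x xs IH] p /=; first by rewrite lcast_id.
have p' : map E (map (fun x => [:: x]) (map F xs)) =
         map E (map (map F) (map (fun x => [:: x]) xs)).
  by rewrite -!map_comp.
rewrite (lcast_cons p erefl p') /= IH comp_idl; congr pair.
rewrite /UEF_unit_ fmap_comp comp_assoc.
rewrite [_ ∘ fmap F (fmap U _)](nt_nat (adj_counit adj)) /=.
by rewrite -comp_assoc adj_triangleF comp_idr.
Qed.

Lemma UEF_unitr (xs : seq W) :
  UEF_sub_ (map (fun x => [:: x]) xs) ∘ lfmap UEFf (lunits UEF_unit_ xs) =
  lfmap UEFf (lcast (esym (flatten_singletons xs))).
Proof.
suff H : UEF_sub_E (map (fun x => [:: x]) xs) ∘
    lfmap E (lmap F (lunits UEF_unit_ xs)) =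
    lfmap E (lmap F (lcast (esym (flatten_singletons xs)))).
  exact: etrans (esym (fmap_comp U _ _)) (f_equal _ H).
rewrite /UEF_sub_E -comp_assoc -lfmap_comp.
have e : map (fun x => [:: x]) (map F xs) =
         map (map F) (map (fun x => [:: x]) xs) by rewrite -!map_comp.
rewrite (lcounits_units (f_equal (map E) e)) lfmap_comp comp_assoc.
rewrite -(comp_assoc _ (msub E _)) (msub_cast e _ (f_equal flatten e)).
rewrite comp_assoc -comp_assoc [msub E _ ∘ _](mt_unitr E (map F xs)).
rewrite -!lfmap_comp !lcast_comp; congr lfmap.
have p : map F xs = map F (flatten (map (fun x => [:: x]) xs)).
  by rewrite flatten_singletons.
rewrite (lmap_cast _ p); congr lcast; exact: proof_irrelevance.
Qed.

Lemma lcounits_subs (xsss : seq (seq (seq W)))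
    (p : map E (map flatten (map (map (map F)) xsss)) =
         map E (map (map F) (map flatten xsss))) :
  lcomp (lcounits (map flatten xsss)) (lmap F (lsubs UEF_sub_ xsss)) =
  lcomp (lcast p) (lcomp (lsubs (msub E) (map (map (map F)) xsss))
    (lcomp (lmap E (lcounits2 xsss)) (lcounits (map (map UEFf) xsss)))).
Proof.
elim: xsss p => [|xss xsss IH] p /=; first by rewrite lcast_id.
have p' : map E (map flatten (map (map (map F)) xsss)) =
         map E (map (map F) (map flatten xsss)).
  by case: p.
have q : E (flatten (map (map F) xss)) = E (map F (flatten xss)).
  by rewrite flatten_map_map.
rewrite (lcast_cons p q p') /= (IH p'); congr pair.
rewrite [LHS](nt_nat (adj_counit adj) (UEF_sub_E xss)) /=.
rewrite -(lfmap_cast (flatten_map_map F xss) q) /UEF_sub_E.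
by rewrite -!comp_assoc.
Qed.

Lemma UEF_assoc (xsss : seq (seq (seq W))) :
  UEF_sub_ (map flatten xsss) ∘ lfmap UEFf (lsubs UEF_sub_ xsss) =
  lfmap UEFf (lcast (flatten_flatten xsss)) ∘ UEF_sub_ (flatten xsss) ∘
  lfmap UEFf (lcast (flatten_map_map UEFf xsss)) ∘
  UEF_sub_ (map (map UEFf) xsss).
Proof.
suff H : UEF_sub_E (map flatten xsss) ∘
    lfmap E (lmap F (lsubs UEF_sub_ xsss)) =
    lfmap E (lmap F (lcast (flatten_flatten xsss))) ∘
    UEF_sub_E (flatten xsss) ∘
    lfmap E (lmap F (lcast (flatten_map_map UEFf xsss))) ∘
    UEF_sub_E (map (map UEFf) xsss).
  apply: etrans (esym (fmap_comp U _ _)) (etrans (f_equal _ H) _).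
  by apply: etrans (fmap_comp U _ _) _; congr (_ ∘ _);
    apply: etrans (fmap_comp U _ _) _; congr (_ ∘ _); apply: (fmap_comp U).
have pD : map F (flatten (map (map UEFf) xsss)) =
          map F (map UEFf (flatten xsss)) by rewrite flatten_map_map.
have pf : map F (flatten (flatten xsss)) = map F (flatten (map flatten xsss)).
  by rewrite flatten_flatten.
rewrite (lmap_cast _ pD) (lmap_cast _ pf).
set X' := map (map (map F)) xsss.
have e1 : map flatten X' = map (map F) (map flatten xsss).
  by rewrite /X' -!map_comp; apply: eq_map => xss /=; rewrite flatten_map_map.
have e2 : flatten X' = map (map F) (flatten xsss) by rewrite flatten_map_map.
have q2 : flatten (map (map E) X') = map E (map (map F) (flatten xsss)).
  by rewrite flatten_map_map e2.
have p2 : flatten (map (map F) (map (map UEFf) xsss)) =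
          map F (map UEFf (flatten xsss)) by rewrite !flatten_map_map.
rewrite /UEF_sub_E -[LHS]comp_assoc -lfmap_comp.
rewrite (lcounits_subs (f_equal (map E) e1)) !lfmap_comp !comp_assoc.
congr (_ ∘ _).
rewrite -[_ ∘ msub E _ ∘ lfmap E (lcast (f_equal _ _))]comp_assoc.
rewrite (msub_cast e1 _ (f_equal flatten e1)) !comp_assoc.
rewrite -[_ ∘ msub E _ ∘ lfmap E (lsubs _ _)]comp_assoc msub_assoc !comp_assoc.
rewrite -[_ ∘ msub E (map (map E) X') ∘ _]comp_assoc.
rewrite msub_nat !comp_assoc; congr (_ ∘ _).
rewrite -!lfmap_comp !lcast_comp -!comp_assoc -!lfmap_comp.
rewrite lcast_comp.
rewrite (proof_irrelevance _ (etrans _ pD) p2) (lcounits_flatten p2 q2).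
have -> : lcast q2 =
    lcomp (lcast (f_equal (map E) e2)) (lcast (flatten_map_map E X')).
  by rewrite lcast_comp; congr lcast; apply: proof_irrelevance.
rewrite -lcomp_assoc [in RHS]lfmap_comp !comp_assoc.
rewrite -[in RHS](comp_assoc _ (msub E _)) (msub_cast e2 _ (f_equal flatten e2)).
rewrite !comp_assoc -!lfmap_comp !lcast_comp.
congr (lfmap E (lcast _) ∘ _ ∘ _); exact: proof_irrelevance.
Qed.

Program Definition UEF : Multitensor W :=
  @MkMultitensor W UEFf
    (@MkNatTrans _ _ (functor_id W) (UEFf ⊚ singleton W) UEF_unit_ _)
    (@MkNatTrans _ _ (UEFf ⊚ SeqFun UEFf) (UEFf ⊚ flatten_functor W) UEF_sub_ _)
    UEF_unitl UEF_unitr UEF_assoc.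
Next Obligation. exact: UEF_unit_nat. Qed.
Next Obligation.
move=> xss yss h; rewrite /UEF_sub_ /= -!fmap_comp; congr fmap.
exact: UEF_sub_nat.
Qed.

End UEF.

Lemma monad_eq (C : Category) (M M' : Monad C) :
  mnd M = mnd M' ->
  (forall x (p : M x = M' x), eq_hom p ∘ mnd_eta M x = mnd_eta M' x) ->
  (forall x (p : M x = M' x) (q : M (M x) = M' (M' x)),
     eq_hom p ∘ mnd_mu M x = mnd_mu M' x ∘ eq_hom q) ->
  M = M'.
Proof.
case: M M' => [T h m l r a] [T' h' m' l' r' a'] /= e; subst T' => eh em.
have ? : h = h' by apply: nt_ext => x; rewrite -(eh x erefl) comp_idl.
have ? : m = m'.
  apply: nt_ext => x.
  by have := em x erefl erefl; rewrite /= comp_idl comp_idr.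
by subst; f_equal; apply: proof_irrelevance.
Qed.

Lemma normal_unit (V : Category) (E : Multitensor V) :
  mt_normal E -> forall x : V, exists p : x = E [:: x], mt_unit E x = eq_hom p.
Proof.
pose P (s : {T : Functor V V & NatTrans (functor_id V) T}) :=
  forall x : V, exists p : x = projT1 s x, projT2 s x = eq_hom p.
rewrite /mt_normal => e.
suff : P (existT _ (E ⊚ singleton V) (mt_unit E)) by [].
by rewrite e => x; exists erefl.
Qed.

Lemma UEF_monad (V W : Category) (F : Functor W V) (U : Functor V W)
    (adj : Adjunction F U) (E : Multitensor V) :
  mt_normal E -> mt_monad (UEF adj E) = adj_monad adj.
Proof.
move=> nE; have eu := normal_unit nE.
have e1 : E ⊚ singleton V = functor_id V by apply: (f_equal (@projT1 _ _) nE).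
have eT : mnd (mt_monad (UEF adj E)) = U ⊚ F.
  transitivity (U ⊚ (E ⊚ singleton V) ⊚ F); first exact: functor_ext.
  by rewrite e1; case: (U) (F) => ? ? ? ? [? ? ? ?]; apply: functor_ext.
apply: monad_eq => //= x p.
  rewrite /UEF_unit_; have [p0 ->] := eu (F x).
  rewrite (fmap_eq_hom _ (f_equal U p0)) comp_assoc eq_hom_comp eq_hom_id.
  by rewrite comp_idl.
move=> q; rewrite /UEF_sub_ /UEF_sub_E lcast_id lfmap_id comp_idl.
have [pb eb] := eu (F x).
have [pa ea] := eu (F (U (E [:: F x]))).
have [pe ee] := eu (E [:: F x]).
have e2 : @lfmap _ _ E [:: _] [:: _] (adj_counit adj (E [:: F x]), tt) =
    eq_hom pe ∘ adj_counit adj (E [:: F x]) ∘ eq_hom (esym pa).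
  have := nt_nat (mt_unit E) (adj_counit adj (E [:: F x])).
  rewrite /= ea ee => ->; rewrite -comp_assoc eq_hom_comp eq_hom_id.
  by rewrite comp_idr.
have e3 : msub E [:: [:: F x]] ∘ eq_hom pe = idm (E [:: F x]).
  by rewrite -ee [LHS]mt_unitl lcast_id lfmap_id.
have e4 : adj_counit adj (E [:: F x]) = eq_hom pb ∘ adj_counit adj (F x) ∘
    fmap F (fmap U (eq_hom (esym pb))).
  have := nt_nat (adj_counit adj) (eq_hom (esym pb)) => /=.
  rewrite -comp_assoc => ->; rewrite comp_assoc eq_hom_comp eq_hom_id.
  by rewrite comp_idl.
rewrite /= e2 !comp_assoc e3 comp_idl e4 !(fmap_comp U).
rewrite (fmap_eq_hom _ (f_equal U pb)) !comp_assoc eq_hom_comp eq_hom_id.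
rewrite comp_idl -!comp_assoc; congr (_ ∘ _).
rewrite (fmap_eq_hom (esym pb) (f_equal U (esym pb))).
rewrite (fmap_eq_hom _ (f_equal F (f_equal U (esym pb)))).
rewrite -(fmap_comp U) eq_hom_comp; set r := etrans _ _.
rewrite (fmap_eq_hom r (f_equal U r)).
by congr eq_hom; apply: proof_irrelevance.
Qed.

Record Graph (V : Category) := MkGraph {
  gr_ob : SmallType;
  gr_hom : gr_ob -> gr_ob -> V
}.
Arguments gr_hom {V} _ _ _.

Record GraphHom (V : Category) (X Y : Graph V) := MkGraphHom {
  gh_ob : gr_ob X -> gr_ob Y;
  gh_hom : forall a b, hom (gr_hom X a b) (gr_hom Y (gh_ob a) (gh_ob b))
}.

Lemma graph_hom_ext (V : Category) (X Y : Graph V) (f : gr_ob X -> gr_ob Y)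
    (g h : forall a b, hom (gr_hom X a b) (gr_hom Y (f a) (f b))) :
  (forall a b, g a b = h a b) -> MkGraphHom g = MkGraphHom h.
Proof.
by move=> e; congr MkGraphHom; do 2![apply: functional_extensionality_dep => ?].
Qed.

Definition graph_id (V : Category) (X : Graph V) : GraphHom X X :=
  {| gh_ob := fun a => a; gh_hom := fun a b => idm (gr_hom X a b) |}.

Definition graph_comp (V : Category) (X Y Z : Graph V) (g : GraphHom Y Z)
    (f : GraphHom X Y) : GraphHom X Z :=
  {| gh_ob := fun a => gh_ob g (gh_ob f a);
     gh_hom := fun a b => gh_hom g (gh_ob f a) (gh_ob f b) ∘ gh_hom f a b |}.

Lemma graph_comp_idl (V : Category) (X Y : Graph V) (f : GraphHom X Y) :
  graph_comp (graph_id Y) f = f.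
Proof. by case: f => f g; apply: graph_hom_ext => a b; apply: comp_idl. Qed.

Lemma graph_comp_idr (V : Category) (X Y : Graph V) (f : GraphHom X Y) :
  graph_comp f (graph_id X) = f.
Proof. by case: f => f g; apply: graph_hom_ext => a b; apply: comp_idr. Qed.

Lemma graph_comp_assoc (V : Category) (X Y Z T : Graph V) (h : GraphHom Z T)
    (g : GraphHom Y Z) (f : GraphHom X Y) :
  graph_comp h (graph_comp g f) = graph_comp (graph_comp h g) f.
Proof. by apply: graph_hom_ext => a b; apply: comp_assoc. Qed.

Definition GraphCat (V : Category) : Category :=
  @MkCategory (Graph V) (@IsCategory (Graph V) (@GraphHom V) (@graph_id V)
    (@graph_comp V) (@graph_comp_idl V) (@graph_comp_idr V)
    (@graph_comp_assoc V)).

(** A path [x_0, ..., x_n] is given by its source [a = x_0] and the sequence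
    [s = x_1, ..., x_n]; its target is [last a s], and
    [pairmap (gr_hom X) a s] is the sequence of the [X(x_{i-1}, x_i)]. *)
Section Paths.
Variables (V : Category) (X : Graph V).

Fixpoint path_targets (a : gr_ob X) (ss : seq (seq (gr_ob X))) :
    seq (gr_ob X) :=
  match ss with
  | [::] => [::]
  | s :: ss' => last a s :: path_targets (last a s) ss'
  end.

Fixpoint paths_homs (a : gr_ob X) (ss : seq (seq (gr_ob X))) : seq (seq V) :=
  match ss with
  | [::] => [::]
  | s :: ss' => pairmap (gr_hom X) a s :: paths_homs (last a s) ss'
  end.

Lemma flatten_paths_homs a ss :
  flatten (paths_homs a ss) = pairmap (gr_hom X) a (flatten ss).
Proof. by elim: ss a => //= s ss IH a; rewrite pairmap_cat IH. Qed.

Lemma last_path_targets a ss : last a (flatten ss) = last a (path_targets a ss).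
Proof. by elim: ss a => //= s ss IH a; rewrite last_cat IH. Qed.

Fixpoint lcompositions (E : Functor (SeqCat V) V)
    (comp : forall a s,
       hom (E (pairmap (gr_hom X) a s)) (gr_hom X a (last a s))) a ss :
    lhom (map E (paths_homs a ss)) (pairmap (gr_hom X) a (path_targets a ss)) :=
  match ss with
  | [::] => tt
  | s :: ss' => (comp a s, lcompositions comp (last a s) ss')
  end.

End Paths.

Fixpoint path_map (V : Category) (X Y : Graph V) (f : GraphHom X Y)
    (a : gr_ob X) (s : seq (gr_ob X)) :
    lhom (pairmap (gr_hom X) a s)
      (pairmap (gr_hom Y) (gh_ob f a) (map (gh_ob f) s)) :=
  match s with
  | [::] => tt
  | b :: s' => (gh_hom f a b, path_map f b s')
  end.

Record ECategory (V : Category) (E : Multitensor V) := MkECategory {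
  ec_graph :> Graph V;
  ec_comp : forall a s,
    hom (E (pairmap (gr_hom ec_graph) a s)) (gr_hom ec_graph a (last a s));
  ec_unit : forall a b,
    ec_comp a [:: b] ∘ mt_unit E (gr_hom ec_graph a b) =
    idm (gr_hom ec_graph a b);
  ec_assoc : forall a ss,
    ec_comp a (path_targets a ss) ∘ lfmap E (lcompositions ec_comp a ss) =
    eq_hom (f_equal (gr_hom ec_graph a) (last_path_targets a ss)) ∘
      ec_comp a (flatten ss) ∘
      lfmap E (lcast (flatten_paths_homs a ss)) ∘
      mt_sub E (paths_homs a ss)
}.
Arguments ec_comp {V E} _ _ _.
Arguments ec_unit {V E} _ _ _.
Arguments ec_assoc {V E} _ _ _.

Record EFunctor (V : Category) (E : Multitensor V) (X Y : ECategory E) :=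
  MkEFunctor {
  ef_graph :> GraphHom X Y;
  ef_comp : forall a s,
    gh_hom ef_graph a (last a s) ∘ ec_comp X a s =
    eq_hom (f_equal (gr_hom Y (gh_ob ef_graph a))
      (last_map (gh_ob ef_graph) s a)) ∘
      ec_comp Y (gh_ob ef_graph a) (map (gh_ob ef_graph) s) ∘
      lfmap E (path_map ef_graph a s)
}.

Lemma efunctor_ext (V : Category) (E : Multitensor V) (X Y : ECategory E)
    (f g : EFunctor X Y) : ef_graph f = ef_graph g -> f = g.
Proof.
by case: f g => [f hf] [g hg] /= e; subst g; f_equal; apply: proof_irrelevance.
Qed.

Lemma ec_comp_cast (V : Category) (E : Multitensor V) (X : ECategory E)
    a s s' (e : s = s') p q :
  ec_comp X a s' ∘ lfmap E (lcast p) = eq_hom q ∘ ec_comp X a s.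
Proof. by subst s'; rewrite lcast_id lfmap_id eq_hom_id comp_idl comp_idr. Qed.

Lemma path_map_id (V : Category) (X : Graph V) a s
    (p : pairmap (gr_hom X) a s = pairmap (gr_hom X) a (map id s)) :
  path_map (graph_id X) a s = lcast p.
Proof.
elim: s a p => [|b s IH] a p /=; first by rewrite lcast_id.
have p' : pairmap (gr_hom X) b s = pairmap (gr_hom X) b (map id s)
  by rewrite map_id.
by rewrite (IH b p') (lcast_cons p erefl p').
Qed.

Lemma path_map_comp (V : Category) (X Y Z : Graph V) (g : GraphHom Y Z)
    (f : GraphHom X Y) a s
    (p : pairmap (gr_hom Z) (gh_ob g (gh_ob f a))
           (map (gh_ob g) (map (gh_ob f) s)) =
         pairmap (gr_hom Z) (gh_ob g (gh_ob f a))
           (map (fun x => gh_ob g (gh_ob f x)) s)) :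
  path_map (graph_comp g f) a s =
  lcomp (lcast p) (lcomp (path_map g (gh_ob f a) (map (gh_ob f) s))
    (path_map f a s)).
Proof.
elim: s a p => [|b s IH] a p /=; first by rewrite lcast_id.
have p' : pairmap (gr_hom Z) (gh_ob g (gh_ob f b))
           (map (gh_ob g) (map (gh_ob f) s)) =
         pairmap (gr_hom Z) (gh_ob g (gh_ob f b))
           (map (fun x => gh_ob g (gh_ob f x)) s) by rewrite -map_comp.
by rewrite (IH b p') (lcast_cons p erefl p') /= comp_idl.
Qed.

Program Definition efunctor_id (V : Category) (E : Multitensor V)
  (X : ECategory E) : EFunctor X X := {| ef_graph := graph_id X |}.
Next Obligation.
move=> V E X a s.
have e : s = map id s by rewrite map_id.
have p : pairmap (gr_hom X) a s = pairmap (gr_hom X) a (map id s) by rewrite -e.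
have q : gr_hom X a (last a s) = gr_hom X a (last a (map id s)) by rewrite -e.
rewrite (path_map_id p) -comp_assoc.
rewrite [ec_comp X _ _ ∘ _](ec_comp_cast e p q) comp_assoc eq_hom_comp.
by rewrite eq_hom_id.
Qed.

Program Definition efunctor_comp (V : Category) (E : Multitensor V)
  (X Y Z : ECategory E) (g : EFunctor Y Z) (f : EFunctor X Y) :
  EFunctor X Z := {| ef_graph := graph_comp g f |}.
Next Obligation.
move=> V E X Y Z g f a s /=.
set s' := map _ s.
have e : map (gh_ob g) (map (gh_ob f) s) = s' by rewrite -map_comp.
have p : pairmap (gr_hom Z) (gh_ob g (gh_ob f a))
           (map (gh_ob g) (map (gh_ob f) s)) =
         pairmap (gr_hom Z) (gh_ob g (gh_ob f a)) s' by rewrite e.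
have q : gr_hom Z (gh_ob g (gh_ob f a))
           (last (gh_ob g (gh_ob f a)) (map (gh_ob g) (map (gh_ob f) s))) =
         gr_hom Z (gh_ob g (gh_ob f a)) (last (gh_ob g (gh_ob f a)) s')
  by rewrite e.
rewrite (path_map_comp p) !lfmap_comp !comp_assoc.
rewrite -[_ ∘ ec_comp Z _ _ ∘ _]comp_assoc (ec_comp_cast e p q).
rewrite !comp_assoc eq_hom_comp -comp_assoc ef_comp !comp_assoc.
congr (_ ∘ _).
have nat b c (r : b = c) (t : gr_hom Z _ (gh_ob g b) = gr_hom Z _ (gh_ob g c)) :
    gh_hom g (gh_ob f a) c ∘ eq_hom (f_equal (gr_hom Y (gh_ob f a)) r) =
    eq_hom t ∘ gh_hom g (gh_ob f a) b.
  by case: c / r t => t; rewrite !eq_hom_id comp_idr comp_idl.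
have t : gr_hom Z (gh_ob g (gh_ob f a))
           (gh_ob g (last (gh_ob f a) (map (gh_ob f) s))) =
         gr_hom Z (gh_ob g (gh_ob f a)) (gh_ob g (gh_ob f (last a s))).
  by rewrite last_map.
rewrite (nat _ _ _ t) -comp_assoc ef_comp !comp_assoc eq_hom_comp.
congr (_ ∘ _ ∘ _); congr eq_hom; exact: proof_irrelevance.
Qed.

Program Definition ECat (V : Category) (E : Multitensor V) : Category :=
  @MkCategory (ECategory E) (@IsCategory (ECategory E) (@EFunctor V E)
    (@efunctor_id V E) (@efunctor_comp V E) _ _ _).
Next Obligation. by move=> *; apply: efunctor_ext; apply: graph_comp_idl. Qed.
Next Obligation. by move=> *; apply: efunctor_ext; apply: graph_comp_idr. Qed.
Next Obligation. by move=> *; apply: efunctor_ext; apply: graph_comp_assoc. Qed.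

Definition ecat_graph (V : Category) (E : Multitensor V) :
    Functor (ECat E) (GraphCat V) :=
  @MkFunctor (ECat E) (GraphCat V) (fun X => ec_graph X)
    (fun X Y f => ef_graph f) (fun _ => erefl) (fun _ _ _ _ _ => erefl).

(** The homs of an [E]-category are algebras for the monad [E_1] under unary
    composition. *)
Program Definition ecat_algebra_graph (V : Category) (E : Multitensor V)
    (X : ECategory E) : Graph (EM (mt_monad E)) :=
  @MkGraph (EM (mt_monad E)) (gr_ob X) (fun a b =>
    @MkAlgebra V (mt_monad E) (gr_hom X a b) (ec_comp X a [:: b]) _ _).
Next Obligation. by move=> V E X a b; apply: ec_unit. Qed.
Next Obligation.
move=> V E X a b; rewrite [LHS](ec_assoc X a [:: [:: b]]).
by rewrite eq_hom_id lcast_id lfmap_id comp_idl comp_idr.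
Qed.

Program Definition ecat_algebras (V : Category) (E : Multitensor V) :
    Functor (ECat E) (GraphCat (EM (mt_monad E))) :=
  @MkFunctor (ECat E) (GraphCat (EM (mt_monad E))) (@ecat_algebra_graph V E)
    (fun X Y f => @MkGraphHom _ (ecat_algebra_graph X) (ecat_algebra_graph Y)
       (gh_ob f) (fun a b => @MkAlgHom _ _ _ _ (gh_hom f a b) _)) _ _.
Next Obligation.
by move=> V E X Y f a b; rewrite [LHS](ef_comp f a [:: b]) eq_hom_id comp_idl.
Qed.
Next Obligation.
by move=> V E X; apply: graph_hom_ext => a b; apply: alg_hom_ext.
Qed.
Next Obligation.
by move=> V E X Y Z g f; apply: graph_hom_ext => a b; apply: alg_hom_ext.
Qed.

Definition is_lifted (W : Category) (D : Multitensor W)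
    (D' : Multitensor (EM (mt_monad D))) : Prop :=
  [/\ mt_normal D', mt_distributive D'
    & exists Phi : CatIso (ECat D') (ECat D),
        ecat_algebras D ⊚ Phi = ecat_graph D'].
Arguments is_lifted {W} D D'.

Program Definition eq_nt (C D : Category) (F G : Functor C D) (p : F = G) :
    NatTrans F G :=
  {| nt := fun x => eq_hom (f_equal (fun H : Functor C D => H x) p) |}.
Next Obligation.
by move=> C D F G p x y f; case: G / p; rewrite comp_idl comp_idr.
Qed.

(** The inverse of an isomorphism of categories is left adjoint to it, with
    identities as unit and counit. *)
Program Definition iso_adjunction (C D : Category) (K : CatIso C D) :
    Adjunction (inverse (iso_inv K)) K :=
  {| adj_unit := eq_nt (esym (Kinverse (iso_inv K)));
     adj_counit := eq_nt (inverseK (iso_inv K)) |}.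
Next Obligation.
move=> C D K d /=; set p := f_equal _ (esym _).
rewrite (fmap_eq_hom p (f_equal _ p)) eq_hom_comp; exact: eq_hom_id.
Qed.
Next Obligation.
move=> C D K d /=; set p := f_equal _ (inverseK _).
rewrite (fmap_eq_hom p (f_equal _ p)) eq_hom_comp; exact: eq_hom_id.
Qed.

(** The multitensor on [D] corresponding to [E] under [K : C ≅ D], namely
    [K E K^-1]. *)
Definition transport (C D : Category) (K : CatIso C D) (E : Multitensor C) :
  Multitensor D := UEF (iso_adjunction K) E.

(** [V ≅ W^{UF} = W^{(UEF)_1}]: the comparison isomorphism, followed by the
    equality of monads [UF = (UEF)_1]. *)
Definition comparison_iso (V W : Category) (F : Functor W V) (U : Functor V W)
    (adj : Adjunction F U) (hU : monadic adj) (E : Multitensor V)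
    (hE : mt_normal E) : CatIso V (EM (mt_monad (UEF adj E))) :=
  eq_rect_r (fun T : Monad W => CatIso V (EM T))
    (MkCatIso hU) (UEF_monad adj hE).

(* Main.v *)
From Stdlib Require Import FunctionalExtensionality ProofIrrelevance.
From Stdlib Require Import IndefiniteDescription.
From mathcomp Require Import all_boot.
Require Import Defs.

(** Existence.  The counit makes [U] a lax functor from [E] to [UEF], so every
    [E]-category has an underlying [UEF]-category.  When [U] is monadic and [E]
    is closed, this is an isomorphism of categories.  Indeed, the unary
    compositions of a [UEF]-category, restricted along the unit of [E], make its
    homs algebras for [UF], that is, objects of [V].  Each object [v] of [V] is
    the reflexive coequalizer of [F U F U v ⇉ F U v], and a functor preserving
    reflexive coequalizers in each variable preserves them in all variables
    jointly; so the composition maps [U E (F U v_i) -> U v] factor uniquely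
    through [U E (v_i)].

    The transport [T] of [E] along the comparison [K] is [K E K^-1], to which
    the same result applies.  Hence [T-Cat ≅ E-Cat ≅ UEF-Cat], and [T] is a
    lifted multitensor.

    Uniqueness.  If [P], [Q] are distributive and [P-Cat ≅ Q-Cat] over graphs,
    let [X] be the free [Q]-category on a path [0 -> 1 -> ... -> n] with homs
    [x_1, ..., x_n].  By distributivity [X(0, n) = Q (x_1, ..., x_n)], so the
    [P]-structure that corresponds to [X] gives a map
    [P (x_1, ..., x_n) -> Q (x_1, ..., x_n)], and freeness of [X] makes these
    maps the components of an isomorphism of multitensors. *)

Set Implicit Arguments.
Unset Strict Implicit.
Unset Printing Implicit Defensive.
Local Open Scope cat_scope.
Local Obligation Tactic := idtac.

Definition witness (T : Type) (P : T -> Prop) (h : exists x, P x) : T :=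
  proj1_sig (constructive_indefinite_description P h).

Lemma witnessP (T : Type) (P : T -> Prop) (h : exists x, P x) : P (witness h).
Proof. exact: proj2_sig. Qed.

(** * Equality of morphisms up to casts of their endpoints *)

Definition heq (C : Category) (x y x' y' : C) (f : hom x y) (g : hom x' y') :=
  exists (p : x = x') (q : y = y'), eq_hom q ∘ f = g ∘ eq_hom p.

Notation "f ≈ g" := (heq f g) (at level 70) : cat_scope.
Notation lheq f g := (@heq (SeqCat _) _ _ _ _ f g).

Section HeterogeneousEquality.
Variable C : Category.

Lemma heq_refl (x y : C) (f : hom x y) : f ≈ f.
Proof. by exists erefl, erefl; rewrite comp_idl comp_idr. Qed.

Lemma eq_heq (x y : C) (f g : hom x y) : f = g -> f ≈ g.
Proof. by move=> ->; apply: heq_refl. Qed.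

Lemma heq_eq (x y : C) (f g : hom x y) : f ≈ g -> f = g.
Proof. by case=> p [q]; rewrite !eq_hom_id comp_idl comp_idr. Qed.

Lemma heq_codomain (x y x' y' : C) (f : hom x y) (g : hom x' y') :
  f ≈ g -> y = y'.
Proof. by case=> p [q _]. Qed.

Lemma heq_sym (x y x' y' : C) (f : hom x y) (g : hom x' y') : f ≈ g -> g ≈ f.
Proof.
move=> fg; case: (fg) => p [q _]; subst.
by rewrite (heq_eq fg); apply: heq_refl.
Qed.

Lemma heq_trans (x y x' y' x'' y'' : C) (f : hom x y) (g : hom x' y')
    (h : hom x'' y'') : f ≈ g -> g ≈ h -> f ≈ h.
Proof. by move=> fg; case: (fg) => p [q _]; subst; rewrite (heq_eq fg). Qed.

Lemma heq_comp (x y z x' y' z' : C) (g : hom y z) (f : hom x y)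
    (g' : hom y' z') (f' : hom x' y') : g ≈ g' -> f ≈ f' -> g ∘ f ≈ g' ∘ f'.
Proof.
move=> gg ff; case: (gg) => p [q _]; case: (ff) => r [s _]; subst.
by rewrite (heq_eq gg) (heq_eq ff); apply: heq_refl.
Qed.

Lemma heq_idm (x x' : C) : x = x' -> idm x ≈ idm x'.
Proof. by move=> ->; apply: heq_refl. Qed.

Lemma eq_hom_heq (x y z : C) (p : x = y) : x = z -> eq_hom p ≈ idm z.
Proof. by move=> <-; subst y; apply: heq_refl. Qed.

Lemma heq_idl (x y z t : C) (g : hom y z) (f : hom x y) :
  g ≈ idm t -> g ∘ f ≈ f.
Proof.
move=> gt; case: (gt) => p [q _]; subst.
by rewrite (heq_eq gt) comp_idl; apply: heq_refl.
Qed.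

Lemma heq_idr (x y z t : C) (g : hom y z) (f : hom x y) :
  f ≈ idm t -> g ∘ f ≈ g.
Proof.
move=> ft; case: (ft) => p [q _]; subst.
by rewrite (heq_eq ft) comp_idr; apply: heq_refl.
Qed.

Lemma heq_castl (x y z : C) (p : y = z) (f : hom x y) : eq_hom p ∘ f ≈ f.
Proof. exact: heq_idl (eq_hom_heq p erefl). Qed.

Lemma heq_castr (x y z : C) (p : x = y) (f : hom y z) : f ∘ eq_hom p ≈ f.
Proof. exact: heq_idr (eq_hom_heq p erefl). Qed.

End HeterogeneousEquality.

Lemma lheq_cons (C : Category) (x y x' y' : C) (xs ys xs' ys' : seq C)
    (f : hom x y) (fs : lhom xs ys) (g : hom x' y') (gs : lhom xs' ys') :
  f ≈ g -> lheq fs gs ->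
  lheq ((f, fs) : lhom (x :: xs) (y :: ys))
       ((g, gs) : lhom (x' :: xs') (y' :: ys')).
Proof.
move=> fg fgs; case: (fg) => p [q _]; case: (fgs) => ps [qs _]; subst.
by rewrite (heq_eq fg) (heq_eq fgs); apply: heq_refl.
Qed.

Lemma lheq_cat (C : Category) (xs ys xs' ys' zs ts zs' ts' : seq C)
    (f : lhom xs ys) (g : lhom xs' ys') (f' : lhom zs ts) (g' : lhom zs' ts') :
  lheq f g -> lheq f' g' -> lheq (lcat f f') (lcat g g').
Proof.
move=> fg fg'; case: (fg) => p [q _]; case: (fg') => p' [q' _]; subst.
by rewrite (heq_eq fg) (heq_eq fg'); apply: heq_refl.
Qed.

Section HeqFunctor.
Variables (C D : Category) (G : Functor C D).

Lemma heq_fmap (x y x' y' : C) (f : hom x y) (g : hom x' y') :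
  f ≈ g -> fmap G f ≈ fmap G g.
Proof.
move=> fg; case: (fg) => p [q _]; subst.
by rewrite (heq_eq fg); apply: heq_refl.
Qed.

Lemma heq_fmap_id (x y z : C) (f : hom x y) :
  f ≈ idm z -> fmap G f ≈ idm (G z).
Proof. by move=> /heq_fmap; rewrite fmap_id. Qed.

End HeqFunctor.

Lemma lheq_eq (C : Category) (xs ys : seq C) (f g : lhom xs ys) :
  lheq f g -> f = g.
Proof. exact: (@heq_eq (SeqCat C)). Qed.

Section HeqCast.
Variables (C D : Category) (G : Functor (SeqCat C) D).

Lemma lfmap_cast_heq (xs ys : seq C) (p : xs = ys) :
  lfmap G (lcast p) ≈ idm (G xs).
Proof. exact: heq_fmap_id (@eq_hom_heq (SeqCat C) _ _ _ p erefl). Qed.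

Lemma heq_lfmap (xs ys xs' ys' : seq C) (f : lhom xs ys) (g : lhom xs' ys') :
  lheq f g -> lfmap G f ≈ lfmap G g.
Proof. exact: heq_fmap. Qed.

Lemma heq_lcastl (x : D) (xs ys : seq C) (p : xs = ys) (f : hom x (G xs)) :
  lfmap G (lcast p) ∘ f ≈ f.
Proof. exact: heq_idl (lfmap_cast_heq p). Qed.

Lemma heq_lcastr (x : D) (xs ys : seq C) (p : xs = ys) (f : hom (G ys) x) :
  f ∘ lfmap G (lcast p) ≈ f.
Proof. exact: heq_idr (lfmap_cast_heq p). Qed.

Lemma heq_comp_lcast (x y x' y' : D) (xs ys xs' ys' : seq C)
    (g : hom (G ys) y) (p : xs = ys) (f : hom x (G xs))
    (g' : hom (G ys') y') (p' : xs' = ys') (f' : hom x' (G xs')) :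
  g ≈ g' -> f ≈ f' ->
  g ∘ lfmap G (lcast p) ∘ f ≈ g' ∘ lfmap G (lcast p') ∘ f'.
Proof.
move=> gg; apply: heq_comp; apply: heq_trans (heq_lcastr _ _) _.
exact: heq_trans gg (heq_sym (heq_lcastr _ _)).
Qed.

End HeqCast.

(** * Functors and isomorphisms of categories *)

Lemma functor_eq (C D : Category) (F G : Functor C D) :
  (forall x, F x = G x) ->
  (forall x y (f : hom x y), fmap F f ≈ fmap G f) -> F = G.
Proof.
case: F G => [f m i c] [f' m' i' c'] /= eq_ob eq_map.
have eq_f : f = f' by apply: functional_extensionality.
by subst f'; apply: functor_ext => x y h; apply: heq_eq.
Qed.

Lemma eq_functor_ob (C D : Category) (F G : Functor C D) (x : C) :
  F = G -> F x = G x.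
Proof. by move=> ->. Qed.

Lemma eq_functor_map (C D : Category) (F G : Functor C D) (x y : C)
    (f : hom x y) : F = G -> fmap F f ≈ fmap G f.
Proof. by move=> ->; apply: heq_refl. Qed.

Lemma functor_compA (A B C D : Category) (H : Functor C D) (G : Functor B C)
    (F : Functor A B) : H ⊚ (G ⊚ F) = H ⊚ G ⊚ F.
Proof. exact: functor_ext. Qed.

Lemma functor_comp_idl (C D : Category) (F : Functor C D) :
  functor_id D ⊚ F = F.
Proof. by case: F => *; apply: functor_ext. Qed.

Lemma functor_comp_idr (C D : Category) (F : Functor C D) :
  F ⊚ functor_id C = F.
Proof. by case: F => *; apply: functor_ext. Qed.

Definition faithful (C D : Category) (K : Functor C D) :=
  forall x y (f g : hom x y), fmap K f = fmap K g -> f = g.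

Definition full (C D : Category) (K : Functor C D) :=
  forall x y (g : hom (K x) (K y)), exists f, fmap K f = g.

Section InvertibleFunctors.
Variables (C D : Category) (K : Functor C D).

Section Inverse.
Hypothesis K_inv : invertible K.

Lemma inverse_ob x : inverse K_inv (K x) = x.
Proof. exact: eq_functor_ob (inverseK K_inv). Qed.

Lemma ob_inverse y : K (inverse K_inv y) = y.
Proof. exact: eq_functor_ob (Kinverse K_inv). Qed.

Lemma inverse_fmap x y (f : hom x y) : fmap (inverse K_inv) (fmap K f) ≈ f.
Proof. exact: eq_functor_map f (inverseK K_inv). Qed.

Lemma fmap_inverse x y (f : hom x y) : fmap K (fmap (inverse K_inv) f) ≈ f.
Proof. exact: eq_functor_map f (Kinverse K_inv). Qed.

Lemma invertible_faithful : faithful K.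
Proof.
move=> x y f g e; apply: heq_eq; apply: heq_trans (heq_sym (inverse_fmap f)) _.
by rewrite e; apply: inverse_fmap.
Qed.

Lemma invertible_full : full K.
Proof.
move=> x y g.
exists (eq_hom (inverse_ob y) ∘ fmap (inverse K_inv) g ∘
        eq_hom (esym (inverse_ob x))).
apply: heq_eq; apply: heq_trans (fmap_inverse g); apply: heq_fmap.
exact: heq_trans (heq_castr _ _) (heq_castl _ _).
Qed.

Lemma invertible_inj : injective K.
Proof. by move=> x y e; rewrite -(inverse_ob x) e inverse_ob. Qed.

End Inverse.

Section Bijective.
Hypotheses (K_faithful : faithful K) (K_full : full K).
Hypotheses (K_inj : injective K) (K_surj : forall y, exists x, K x = y).

Let inv_ob y := witness (K_surj y).

Let inv_obK y : K (inv_ob y) = y.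
Proof. exact: (witnessP (K_surj y)). Qed.

Let inv_map x y (f : hom x y) : hom (inv_ob x) (inv_ob y) :=
  witness (K_full (eq_hom (esym (inv_obK y)) ∘ f ∘ eq_hom (inv_obK x))).

Let inv_mapK x y (f : hom x y) : fmap K (inv_map f) ≈ f.
Proof.
rewrite (witnessP (K_full _)).
exact: heq_trans (heq_castr _ _) (heq_castl _ _).
Qed.

Let inv_map_id x : inv_map (idm x) = idm (inv_ob x).
Proof.
apply: K_faithful; apply: heq_eq; apply: heq_trans (inv_mapK _) _.
by rewrite fmap_id; apply: heq_idm; rewrite inv_obK.
Qed.

Let inv_map_comp x y z (g : hom y z) (f : hom x y) :
  inv_map (g ∘ f) = inv_map g ∘ inv_map f.
Proof.
apply: K_faithful; apply: heq_eq; apply: heq_trans (inv_mapK _) _.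
by rewrite fmap_comp; apply/heq_sym/heq_comp.
Qed.

Lemma invertible_of_bijective : invertible K.
Proof.
pose G := @MkFunctor D C inv_ob inv_map inv_map_id inv_map_comp.
have GK x : G (K x) = x by apply: K_inj; apply: inv_obK.
apply: (@Invertible C D K G); apply: functor_eq => //= x y f.
have GKf : eq_hom (GK y) ∘ fmap G (fmap K f) ∘ eq_hom (esym (GK x)) = f.
  apply: K_faithful; apply: heq_eq; apply: heq_trans (inv_mapK _).
  by apply: heq_fmap; apply: heq_trans (heq_castr _ _) (heq_castl _ _).
apply: heq_trans (eq_heq GKf); apply: heq_sym.
exact: heq_trans (heq_castr _ _) (heq_castl _ _).
Qed.

End Bijective.
End InvertibleFunctors.

Definition iso_sym (C D : Category) (K : CatIso C D) : CatIso D C :=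
  MkCatIso (Invertible (Kinverse (iso_inv K)) (inverseK (iso_inv K))).

Lemma invertible_comp (B C D : Category) (K : Functor C D) (H : Functor B C) :
  invertible K -> invertible H -> invertible (K ⊚ H).
Proof.
move=> [K' K'K KK'] [H' H'H HH']; apply: (@Invertible _ _ _ (H' ⊚ K')).
  by rewrite -functor_compA (functor_compA K') K'K functor_comp_idl.
by rewrite -functor_compA (functor_compA H) HH' functor_comp_idl.
Qed.

Definition iso_comp (B C D : Category) (K : CatIso C D) (H : CatIso B C) :
    CatIso B D := MkCatIso (invertible_comp (iso_inv K) (iso_inv H)).

(** * Composition maps on a graph *)

Definition compositions (V : Category) (E : Functor (SeqCat V) V)
    (X : Graph V) : Type :=
  forall a s, hom (E (pairmap (gr_hom X) a s)) (gr_hom X a (last a s)).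

Section CompositionLaws.
Variables (V : Category) (E : Multitensor V).

Definition comp_unital (X : Graph V) (c : compositions E X) : Prop :=
  forall a b, c a [:: b] ∘ mt_unit E (gr_hom X a b) = idm (gr_hom X a b).

Definition comp_associative (X : Graph V) (c : compositions E X) : Prop :=
  forall a ss,
    c a (path_targets a ss) ∘ lfmap E (lcompositions c a ss) =
    eq_hom (f_equal (gr_hom X a) (last_path_targets a ss)) ∘
      c a (flatten ss) ∘
      lfmap E (lcast (flatten_paths_homs a ss)) ∘
      mt_sub E (paths_homs a ss).

Definition preserves_comp (X Y : Graph V) (c : compositions E X)
    (d : compositions E Y) (f : GraphHom X Y) : Prop :=
  forall a s,
    gh_hom f a (last a s) ∘ c a s =
    eq_hom (f_equal (gr_hom Y (gh_ob f a)) (last_map (gh_ob f) s a)) ∘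
      d (gh_ob f a) (map (gh_ob f) s) ∘ lfmap E (path_map f a s).

Lemma comp_associativeP (X : Graph V) (c : compositions E X) :
  comp_associative c <-> forall a ss,
    c a (path_targets a ss) ∘ lfmap E (lcompositions c a ss) ≈
    c a (flatten ss) ∘ lfmap E (lcast (flatten_paths_homs a ss)) ∘
      msub E (paths_homs a ss).
Proof.
split=> h a ss.
  by rewrite h -!comp_assoc; apply: heq_castl.
apply: heq_eq; apply: heq_trans (h a ss) _; rewrite -!comp_assoc.
exact/heq_sym/heq_castl.
Qed.

Lemma preserves_compP (X Y : Graph V) (c : compositions E X)
    (d : compositions E Y) (f : GraphHom X Y) :
  preserves_comp c d f <-> forall a s,
    gh_hom f a (last a s) ∘ c a s ≈
    d (gh_ob f a) (map (gh_ob f) s) ∘ lfmap E (path_map f a s).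
Proof.
split=> h a s; first by rewrite h -comp_assoc; apply: heq_castl.
apply: heq_eq; apply: heq_trans (h a s) _; rewrite -comp_assoc.
exact/heq_sym/heq_castl.
Qed.

Lemma mt_unit_nat (x y : V) (f : hom x y) :
  mt_unit E y ∘ f = @lfmap _ _ E [:: x] [:: y] (f, tt) ∘ mt_unit E x.
Proof. exact: (nt_nat (mt_unit E)). Qed.

Lemma heq_compositions (X : Graph V) (c : compositions E X) a b s t :
  a = b -> s = t -> c a s ≈ c b t.
Proof. by move=> -> ->; apply: heq_refl. Qed.

Lemma heq_msub (xss yss : seq (seq V)) : xss = yss -> msub E xss ≈ msub E yss.
Proof. by move=> ->; apply: heq_refl. Qed.

Lemma ecategory_eq (X : Graph V) (c c' : compositions E X)
    (u : comp_unital c) (u' : comp_unital c')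
    (m : comp_associative c) (m' : comp_associative c') :
  (forall a s, c a s = c' a s) -> MkECategory u m = MkECategory u' m'.
Proof.
move=> e; have ? : c = c' by do 2![apply: functional_extensionality_dep => ?].
by subst c'; f_equal; apply: proof_irrelevance.
Qed.

Lemma ecategory_comp_inj (X : Graph V) (c c' : compositions E X)
    (u : comp_unital c) (u' : comp_unital c')
    (m : comp_associative c) (m' : comp_associative c') :
  MkECategory u m = MkECategory u' m' -> c = c'.
Proof. by case=> e; apply: (EqdepTheory.inj_pair2 _ _ _ _ _ e). Qed.

End CompositionLaws.

Lemma path_targets_singletons (V : Category) (X : Graph V) (a : gr_ob X) s :
  path_targets a (map (fun b => [:: b]) s) = s.
Proof. by elim: s a => //= b s IH a; rewrite IH. Qed.

Lemma paths_homs_singletons (V : Category) (X : Graph V) (a : gr_ob X) s :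
  paths_homs a (map (fun b => [:: b]) s) =
  map (fun x => [:: x]) (pairmap (gr_hom X) a s).
Proof. by elim: s a => //= b s IH a; rewrite IH. Qed.

(** * Change of base along a lax functor *)

Lemma graph_eq (V : Category) (X : Graph V) (h : gr_ob X -> gr_ob X -> V) :
  (forall a b, h a b = gr_hom X a b) -> MkGraph h = X.
Proof.
case: X h => o h' h e; congr MkGraph.
by do 2![apply: functional_extensionality => ?].
Qed.

Lemma graph_hom_eq (V : Category) (X Y : Graph V) (f : GraphHom X Y)
    (h : forall a b, hom (gr_hom X a b) (gr_hom Y (gh_ob f a) (gh_ob f b))) :
  (forall a b, h a b = gh_hom f a b) -> MkGraphHom h = f.
Proof. by case: f h => f f' h; apply: graph_hom_ext. Qed.

Definition map_graph (V W : Category) (H : Functor V W) (X : Graph V) :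
    Graph W := MkGraph (fun a b => H (gr_hom X a b)).

Definition map_graph_hom (V W : Category) (H : Functor V W) (X Y : Graph V)
    (f : GraphHom X Y) : GraphHom (map_graph H X) (map_graph H Y) :=
  @MkGraphHom W (map_graph H X) (map_graph H Y) (gh_ob f)
    (fun a b => fmap H (gh_hom f a b)).

Program Definition graph_functor (V W : Category) (H : Functor V W) :
    Functor (GraphCat V) (GraphCat W) :=
  @MkFunctor (GraphCat V) (GraphCat W) (map_graph H) (@map_graph_hom V W H) _ _.
Next Obligation. by move=> *; apply: graph_hom_ext => *; apply: fmap_id. Qed.
Next Obligation. by move=> *; apply: graph_hom_ext => *; apply: fmap_comp. Qed.

Lemma gh_hom_heq (V : Category) (X Y : Graph V) (f g : GraphHom X Y) a b :
  f = g -> gh_hom f a b ≈ gh_hom g a b.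
Proof. by move=> ->; apply: heq_refl. Qed.

Section GraphFunctor.
Variables (V W : Category) (H : Functor V W).

Lemma graph_functor_faithful : faithful H -> faithful (graph_functor H).
Proof.
move=> H_faithful X Y [f f'] [g g'] e.
have eq_fg : f = g by case: e.
subst g; apply: graph_hom_ext => a b; apply: H_faithful.
exact/heq_eq/(@gh_hom_heq W (map_graph H X) (map_graph H Y) _ _ a b e).
Qed.

Lemma pairmap_map_graph (X : Graph V) (a : gr_ob X) s :
  pairmap (gr_hom (map_graph H X)) a s = map H (pairmap (gr_hom X) a s).
Proof. by elim: s a => //= b s IH a; rewrite IH. Qed.

Lemma paths_homs_map_graph (X : Graph V) (a : gr_ob X) ss :
  paths_homs (X := map_graph H X) a ss = map (map H) (paths_homs a ss).
Proof. by elim: ss a => //= s ss IH a; rewrite IH (pairmap_map_graph a s). Qed.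

Lemma path_map_map_graph (X Y : Graph V) (f : GraphHom X Y) a s :
  lheq (path_map (map_graph_hom H f) a s) (lmap H (path_map f a s)).
Proof.
elim: s a => [|b s IH] a /=; first exact: heq_refl.
by apply: lheq_cons (IH _); apply: heq_refl.
Qed.

End GraphFunctor.

Fixpoint llax (V W : Category) (E : Functor (SeqCat V) V)
    (D : Functor (SeqCat W) W) (H : Functor V W)
    (phi : forall xs : seq V, hom (D (map H xs)) (H (E xs))) xss :
    lhom (map D (map (map H) xss)) (map H (map E xss)) :=
  if xss is xs :: xss' then (phi xs, llax phi xss') else tt.

Record lax_functor (V W : Category) (E : Multitensor V) (D : Multitensor W)
    (H : Functor V W) := LaxFunctor {
  lax_map :> forall xs : seq V, hom (D (map H xs)) (H (E xs));
  lax_map_nat : forall xs ys (f : lhom xs ys),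
    lax_map ys ∘ lfmap D (lmap H f) = fmap H (lfmap E f) ∘ lax_map xs;
  lax_map_unit : forall x,
    lax_map [:: x] ∘ mt_unit D (H x) = fmap H (mt_unit E x);
  lax_map_sub : forall xss,
    fmap H (msub E xss) ∘ lax_map (map E xss) ∘ lfmap D (llax lax_map xss) =
    lax_map (flatten xss) ∘ lfmap D (lcast (flatten_map_map H xss)) ∘
      msub D (map (map H) xss)
}.

Section BaseChange.
Variables (V W : Category) (E : Multitensor V) (D : Multitensor W).
Variables (H : Functor V W) (phi : lax_functor E D H).

Section Compositions.
Variables (X : Graph V) (c : compositions E X).

Definition base_change_comp : compositions D (map_graph H X) :=
  fun a s => fmap H (c a s) ∘ phi _ ∘
    lfmap D (lcast (@pairmap_map_graph V W H X a s)).

Lemma base_change_comp_heq a s : base_change_comp a s ≈ fmap H (c a s) ∘ phi _.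
Proof. exact: heq_lcastr. Qed.

Lemma lcompositions_base_change (a : gr_ob X) ss :
  lheq (lcompositions base_change_comp a ss)
       (lcomp (lmap H (lcompositions c a ss)) (llax phi (paths_homs a ss))).
Proof.
elim: ss a => [|s ss IH] a /=; first exact: heq_refl.
by apply: lheq_cons (IH _); apply: base_change_comp_heq.
Qed.

Lemma base_change_comp_nested (a : gr_ob X) ss :
  base_change_comp a (path_targets a ss) ∘
    lfmap D (lcompositions base_change_comp a ss) ≈
  fmap H (c a (path_targets a ss) ∘ lfmap E (lcompositions c a ss)) ∘
    (phi (map E (paths_homs a ss)) ∘ lfmap D (llax phi (paths_homs a ss))).
Proof.
apply: heq_trans (heq_comp (base_change_comp_heq _ _)
  (heq_lfmap D (lcompositions_base_change a ss))) _.
apply: eq_heq; rewrite lfmap_comp fmap_comp !comp_assoc.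
by rewrite -(comp_assoc _ (phi _)) lax_map_nat !comp_assoc.
Qed.

Lemma base_change_comp_flatten (a : gr_ob X) ss :
  base_change_comp a (flatten ss) ∘
    lfmap D (lcast (flatten_paths_homs (X := map_graph H X) a ss)) ∘
    msub D (paths_homs (X := map_graph H X) a ss) ≈
  fmap H (c a (flatten ss) ∘ lfmap E (lcast (flatten_paths_homs a ss)) ∘
      msub E (paths_homs a ss)) ∘
    (phi (map E (paths_homs a ss)) ∘ lfmap D (llax phi (paths_homs a ss))).
Proof.
rewrite !fmap_comp -(comp_assoc _ (fmap H (msub _ _))).
rewrite (comp_assoc (fmap H (msub _ _))) lax_map_sub !comp_assoc.
apply: heq_comp_lcast; last by apply: heq_msub; apply: paths_homs_map_graph.
apply: heq_trans (base_change_comp_heq _ _) _.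
rewrite -comp_assoc -lax_map_nat; apply: heq_comp; first exact: heq_refl.
rewrite (lmap_cast _ (f_equal (map H) (flatten_paths_homs a ss))).
exact/heq_sym/heq_lcastr.
Qed.

Lemma base_change_unary a b :
  base_change_comp a [:: b] = fmap H (c a [:: b]) ∘ phi [:: gr_hom X a b].
Proof. by rewrite /base_change_comp lcast_id lfmap_id comp_idr. Qed.

Lemma base_change_unital : comp_unital c -> comp_unital base_change_comp.
Proof.
move=> cu a b; rewrite base_change_unary -comp_assoc lax_map_unit.
rewrite -[LHS](fmap_comp H (c a [:: b]) (mt_unit E _)) cu.
by rewrite fmap_id.
Qed.

Lemma base_change_associative :
  comp_associative c -> comp_associative base_change_comp.
Proof.
move=> cA; apply/comp_associativeP => a ss.
apply: heq_trans (base_change_comp_nested a ss) _.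
apply: heq_trans (heq_sym (base_change_comp_flatten a ss)).
apply: heq_comp (heq_refl _); apply: heq_fmap.
exact: (comp_associativeP c).1.
Qed.

End Compositions.

Section Functoriality.
Variables (X Y : Graph V) (c : compositions E X) (d : compositions E Y).
Variable f : GraphHom X Y.

Lemma base_change_comp_source (a : gr_ob X) s :
  gh_hom (map_graph_hom H f) a (last a s) ∘ base_change_comp c a s ≈
  fmap H (gh_hom f a (last a s) ∘ c a s) ∘ phi _.
Proof.
rewrite fmap_comp -comp_assoc; apply: heq_comp (heq_refl _) _.
exact: base_change_comp_heq.
Qed.

Lemma base_change_comp_target (a : gr_ob X) s :
  base_change_comp d (gh_ob f a) (map (gh_ob f) s) ∘
    lfmap D (path_map (map_graph_hom H f) a s) ≈
  fmap H (d (gh_ob f a) (map (gh_ob f) s) ∘ lfmap E (path_map f a s)) ∘ phi _.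
Proof.
rewrite fmap_comp -comp_assoc -lax_map_nat comp_assoc.
by apply: heq_comp (base_change_comp_heq _ _ _) (heq_lfmap D _);
  apply: path_map_map_graph.
Qed.

Lemma base_change_preserves :
  preserves_comp c d f ->
  preserves_comp (base_change_comp c) (base_change_comp d) (map_graph_hom H f).
Proof.
move=> /preserves_compP fP; apply/preserves_compP => a s.
apply: heq_trans (base_change_comp_source a s) _.
apply: heq_trans (heq_sym (base_change_comp_target a s)).
by apply: heq_comp (heq_refl _); apply: heq_fmap.
Qed.

End Functoriality.

Definition base_change_ob (X : ECategory E) : ECategory D :=
  MkECategory (base_change_unital (ec_unit X))
    (base_change_associative (ec_assoc X)).

Definition base_change_hom (X Y : ECategory E) (f : EFunctor X Y) :
    EFunctor (base_change_ob X) (base_change_ob Y) :=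
  @MkEFunctor W D (base_change_ob X) (base_change_ob Y) (map_graph_hom H f)
    (base_change_preserves (ef_comp f)).

Program Definition base_change : Functor (ECat E) (ECat D) :=
  @MkFunctor (ECat E) (ECat D) base_change_ob base_change_hom _ _.
Next Obligation.
by move=> X; apply: efunctor_ext; apply: (@fmap_id _ _ (graph_functor H) X).
Qed.
Next Obligation.
move=> X Y Z g f; apply: efunctor_ext.
exact: (@fmap_comp _ _ (graph_functor H) X Y Z).
Qed.

Lemma ecat_graph_base_change :
  ecat_graph D ⊚ base_change = graph_functor H ⊚ ecat_graph E.
Proof. exact: functor_ext. Qed.

Lemma base_change_faithful : faithful H -> faithful base_change.
Proof.
move=> H_faithful X Y f g e; apply: efunctor_ext.
exact: (graph_functor_faithful H_faithful (f_equal (@ef_graph _ _ _ _) e)).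
Qed.

Definition lax_epic : Prop :=
  forall vs v (k k' : hom (E vs) v),
  fmap H k ∘ phi vs = fmap H k' ∘ phi vs -> k = k'.

Definition lax_epic_nested : Prop :=
  forall vss v (k k' : hom (E (map E vss)) v),
  fmap H k ∘ (phi (map E vss) ∘ lfmap D (llax phi vss)) =
  fmap H k' ∘ (phi (map E vss) ∘ lfmap D (llax phi vss)) -> k = k'.

Lemma base_change_comp_inj (X : Graph V) (c c' : compositions E X) :
  lax_epic -> base_change_comp c = base_change_comp c' -> c = c'.
Proof.
move=> phi_epic e; do 2![apply: functional_extensionality_dep => ?].
apply: phi_epic; apply: heq_eq.
apply: heq_trans (heq_sym (base_change_comp_heq c _ _)) _.
by rewrite e; apply: base_change_comp_heq.
Qed.

Lemma associative_of_base_change (X : Graph V) (c : compositions E X) :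
  lax_epic_nested ->
  comp_associative (base_change_comp c) -> comp_associative c.
Proof.
move=> phi_epic /comp_associativeP cA a ss; apply: phi_epic; apply: heq_eq.
apply: heq_trans (heq_sym (base_change_comp_nested c a ss)) _.
apply: heq_trans (cA a ss) (heq_trans (base_change_comp_flatten c a ss) _).
apply: heq_comp (heq_refl _); apply: heq_fmap; rewrite -!comp_assoc.
exact/heq_sym/heq_castl.
Qed.

Lemma preserves_of_base_change (X Y : Graph V) (c : compositions E X)
    (d : compositions E Y) (f : GraphHom X Y) :
  lax_epic ->
  preserves_comp (base_change_comp c) (base_change_comp d)
    (map_graph_hom H f) ->
  preserves_comp c d f.
Proof.
move=> phi_epic /preserves_compP fP a s; apply: phi_epic; apply: heq_eq.
apply: heq_trans (heq_sym (base_change_comp_source c f a s)) _.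
apply: heq_trans (fP a s) (heq_trans (base_change_comp_target d f a s) _).
apply: heq_comp (heq_refl _); apply: heq_fmap; rewrite -comp_assoc.
exact/heq_sym/heq_castl.
Qed.

End BaseChange.

(** * Reflexive coequalizers *)

Definition epic (C : Category) (x y : C) (e : hom x y) :=
  forall z (g g' : hom y z), g ∘ e = g' ∘ e -> g = g'.

Lemma epic_comp (C : Category) (x y z : C) (g : hom y z) (f : hom x y) :
  epic g -> epic f -> epic (g ∘ f).
Proof. by move=> hg hf t k k'; rewrite !comp_assoc => /hf /hg. Qed.

Definition is_coequalizer (C : Category) (a b c : C) (p q : hom a b)
    (e : hom b c) :=
  [/\ e ∘ p = e ∘ q,
      forall z (f : hom b z), f ∘ p = f ∘ q -> exists g, g ∘ e = f
    & epic e].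

Definition common_section (C : Category) (a b : C) (p q : hom a b)
    (s : hom b a) := p ∘ s = idm b /\ q ∘ s = idm b.

Definition reflexive_coequalizer (C : Category) (a b c : C) (p q : hom a b)
    (e : hom b c) :=
  (exists s, common_section p q s) /\ is_coequalizer p q e.

Section ParallelPair.

Definition pair_hom (i j : bool) : SmallType :=
  match i, j with
  | false, true => bool
  | true, false => Empty_set
  | _, _ => unit
  end.

Definition pair_id (i : bool) : pair_hom i i :=
  match i with true => tt | false => tt end.

Definition pair_comp (i j k : bool) :
    pair_hom j k -> pair_hom i j -> pair_hom i k :=
  match i, j, k return pair_hom j k -> pair_hom i j -> pair_hom i k with
  | false, false, false => fun _ _ => tt
  | false, false, true => fun g _ => g
  | false, true, true => fun _ f => f
  | true, true, true => fun _ _ => tt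
  | false, true, false => fun g _ => match g with end
  | true, true, false => fun g _ => g
  | true, false, _ => fun _ f => match f with end
  end.

Program Definition parallel_pair : SmallCategory :=
  @MkSmallCategory bool (@IsCategory bool pair_hom pair_id pair_comp _ _ _).
Next Obligation. by case=> [] [] []. Qed.
Next Obligation. by case=> [] [] []. Qed.
Next Obligation. by case=> [] [] [] [] // [] [] []. Qed.

Variable C : Category.

Section ParallelFunctor.
Variables (a b : C) (p q : hom a b).

Definition pair_ob (i : bool) : C := if i then b else a.

Definition pair_map (i j : bool) :
    pair_hom i j -> hom (pair_ob i) (pair_ob j) :=
  match i, j return pair_hom i j -> hom (pair_ob i) (pair_ob j) with
  | false, false => fun _ => idm a
  | true, true => fun _ => idm b
  | false, true => fun k => if k then p else q
  | true, false => fun k => match k with end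
  end.

Program Definition pair_functor : Functor parallel_pair C :=
  @MkFunctor parallel_pair C pair_ob pair_map _ _.
Next Obligation. by case. Qed.
Next Obligation.
by case=> [] [] [] // [] [] //=; rewrite ?comp_idl ?comp_idr.
Qed.

End ParallelFunctor.

Lemma pair_cocone_leg_nat (P : Functor parallel_pair C) (c : C)
    (e : hom (P true) c) :
  e ∘ @fmap _ _ P false true true = e ∘ @fmap _ _ P false true false ->
  forall (i j : parallel_pair) (f : hom i j),
  (if j return hom (P j) c then e else e ∘ @fmap _ _ P false true true) ∘
    fmap P f =
  (if i return hom (P i) c then e else e ∘ @fmap _ _ P false true true).
Proof.
by move=> epq [] [] [] //=; rewrite -[RHS]comp_idr; congr (_ ∘ _);
  apply: (fmap_id P).
Qed.

Definition pair_cocone (P : Functor parallel_pair C) (c : C)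
    (e : hom (P true) c)
    (epq : e ∘ @fmap _ _ P false true true = e ∘ @fmap _ _ P false true false) :
    Cocone P :=
  @MkCocone parallel_pair C P c _ (pair_cocone_leg_nat epq).

Lemma parallel_colimitP (P : Functor parallel_pair C) (c : Cocone P) :
  is_colimit c <->
  is_coequalizer (@fmap _ _ P false true true) (@fmap _ _ P false true false)
    (leg c true).
Proof.
have legE (c' : Cocone P) k :
    leg c' true ∘ @fmap _ _ P false true k = leg c' false by exact: leg_nat.
split=> [hc|[_ fact epi] c'].
  split=> [|z f fpq|z g g' gg']; first by rewrite !legE.
    have [g [hg _]] := hc (pair_cocone fpq); exists g; exact: (hg true).
  have fpq : g ∘ leg c true ∘ @fmap _ _ P false true true =
             g ∘ leg c true ∘ @fmap _ _ P false true false.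
    by rewrite -!comp_assoc !legE.
  have [k [_ uk]] := hc (pair_cocone fpq).
  have legs h : h ∘ leg c true = g ∘ leg c true ->
      forall j, h ∘ leg c j = leg (pair_cocone fpq) j.
    by move=> hg [] //=; rewrite -hg -comp_assoc legE.
  by rewrite -(uk g (legs _ erefl)) -(uk g' (legs _ (esym gg'))).
have [g hg] := fact _ (leg c' true) (etrans (legE c' _) (esym (legE c' _))).
exists g; split=> [[]|g' hg'] //; last by apply: epi; rewrite hg hg'.
by rewrite -(legE c true) -(legE c' true) comp_assoc hg.
Qed.

End ParallelPair.

Lemma cocontinuous_coequalizer (C D : Category) (H : Functor C D) (a b c : C)
    (p q : hom a b) (e : hom b c) :
  preserves_colimits H -> is_coequalizer p q e ->
  is_coequalizer (fmap H p) (fmap H q) (fmap H e).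
Proof.
move=> H_cocont hpq; have [epq _ _] := hpq.
have hc : is_colimit (@pair_cocone C (pair_functor p q) c e epq).
  exact/parallel_colimitP.
exact: (parallel_colimitP _).1 (H_cocont _ _ _ hc).
Qed.

(** [p] and [q] are the two diagonals of the square of parallel pairs below;
    the sections [s1] and [s2] recover its edges into [x11] from them.
<<
   x00 ⇉ x10 -e0-> x20
    ⇊     ⇊         ⇊
   x01 ⇉ x11 -e1-> x21 -e2-> x22
>> *)
Lemma diagonal_coequalizer (C : Category) (x00 x01 x10 x11 x20 x21 x22 : C)
    (p q : hom x00 x11) (p1 q1 : hom x01 x11) (e1 : hom x11 x21)
    (p2 q2 : hom x20 x21) (e2 : hom x21 x22)
    (p2' q2' : hom x10 x11) (e0 : hom x10 x20)
    (s1 : hom x01 x00) (s2 : hom x10 x00) :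
  is_coequalizer p1 q1 e1 -> is_coequalizer p2 q2 e2 -> epic e0 ->
  e1 ∘ p2' = p2 ∘ e0 -> e1 ∘ q2' = q2 ∘ e0 ->
  p ∘ s1 = p1 -> q ∘ s1 = q1 -> p ∘ s2 = p2' -> q ∘ s2 = q2' ->
  e2 ∘ e1 ∘ p = e2 ∘ e1 ∘ q ->
  is_coequalizer p q (e2 ∘ e1).
Proof.
move=> [_ fact1 epi1] [_ fact2 epi2] epi0 ep eq ps1 qs1 ps2 qs2 epq.
split=> [//|z f fpq|]; last exact: epic_comp.
have [|f1 f1e] := fact1 z f; first by rewrite -ps1 -qs1 !comp_assoc fpq.
have [|g ge] := fact2 z f1.
  apply: epi0; rewrite -!comp_assoc -ep -eq !comp_assoc f1e -ps2 -qs2.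
  by rewrite !comp_assoc fpq.
by exists g; rewrite comp_assoc ge.
Qed.

Inductive lreflexive_coequalizer (C : Category) : forall xs ys zs : seq C,
    lhom xs ys -> lhom xs ys -> lhom ys zs -> Prop :=
| lreflexive_nil : @lreflexive_coequalizer C [::] [::] [::] tt tt tt
| lreflexive_cons : forall (x y z : C) (p q : hom x y) (e : hom y z) xs ys zs
    (ps qs : lhom xs ys) (es : lhom ys zs),
    reflexive_coequalizer p q e -> lreflexive_coequalizer ps qs es ->
    @lreflexive_coequalizer C (x :: xs) (y :: ys) (z :: zs)
      (p, ps) (q, qs) (e, es).

Lemma lreflexive_section (C : Category) (xs ys zs : seq C) (ps qs : lhom xs ys)
    (es : lhom ys zs) : lreflexive_coequalizer ps qs es ->
  exists ss, @common_section (SeqCat C) xs ys ps qs ss.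
Proof.
elim=> [|x y z p q e {}xs {}ys {}zs {}ps {}qs {}es [[s [ps1 qs1]] _] _ [ss]].
  by exists tt.
by case; rewrite /compm /= => pss qss; exists (s, ss);
  split; rewrite /compm /= ?ps1 ?qs1 ?pss ?qss.
Qed.

Lemma lreflexive_eq (C : Category) (xs ys zs : seq C) (ps qs : lhom xs ys)
    (es : lhom ys zs) : lreflexive_coequalizer ps qs es ->
  lcomp es ps = lcomp es qs.
Proof. by elim=> //= x y z p q e > [_ [-> _ _]] _ ->. Qed.

Program Definition cons_functor (C : Category) (x : C) :
    Functor (SeqCat C) (SeqCat C) :=
  @MkFunctor (SeqCat C) (SeqCat C) (cons x)
    (fun xs ys f => (idm x, f) : lhom (x :: xs) (x :: ys)) _ _.
Next Obligation. by []. Qed.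
Next Obligation.
by move=> C x xs ys zs g f; rewrite /compm /= -/(compm _ _) comp_idl.
Qed.

Definition multi_cocontinuous (C D : Category) (H : Functor (SeqCat C) D) :=
  forall l r : seq C, preserves_colimits (H ⊚ slot l r).

Lemma multi_cocontinuous_cons (C D : Category) (H : Functor (SeqCat C) D) x :
  multi_cocontinuous H -> multi_cocontinuous (H ⊚ cons_functor x).
Proof.
move=> H_cocont l r.
have -> : H ⊚ cons_functor x ⊚ slot l r = H ⊚ slot (x :: l) r.
  exact: functor_ext.
exact: H_cocont.
Qed.

Definition fmap_cons (C D : Category) (H : Functor (SeqCat C) D) (x y : C)
    (xs ys : seq C) (f : hom x y) (fs : lhom xs ys) :
    hom (H (x :: xs)) (H (y :: ys)) :=
  @lfmap _ _ H (x :: xs) (y :: ys) (f, fs).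

Lemma fmap_cons_comp (C D : Category) (H : Functor (SeqCat C) D) (x y z : C)
    (xs ys zs : seq C) (g : hom y z) (gs : lhom ys zs) (f : hom x y)
    (fs : lhom xs ys) :
  fmap_cons H g gs ∘ fmap_cons H f fs = fmap_cons H (g ∘ f) (lcomp gs fs).
Proof.
exact: esym (@lfmap_comp _ _ H (x :: xs) (y :: ys) (z :: zs) (g, gs) (f, fs)).
Qed.

Lemma multi_cocontinuous_coequalizer (C D : Category) (xs ys zs : seq C)
    (ps qs : lhom xs ys) (es : lhom ys zs) :
  lreflexive_coequalizer ps qs es ->
  forall H : Functor (SeqCat C) D, multi_cocontinuous H ->
  is_coequalizer (lfmap H ps) (lfmap H qs) (lfmap H es).
Proof.
elim=> [|x y z p q e {}xs {}ys {}zs {}ps {}qs {}es hpq hpqs IH] H H_cocont.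
  have -> : lfmap H (tt : @lhom C [::] [::]) = idm (H [::]).
    exact: (lfmap_id H [::]).
  split=> // [t f _|t g g']; first by exists f; rewrite comp_idr.
  by rewrite !comp_idr.
have [[s [ps1 qs1]] coeq] := hpq; have [epq _ _] := coeq.
have [ss [pss qss]] := lreflexive_section hpqs.
have head_coeq ts : is_coequalizer (fmap_cons H p (lid ts))
    (fmap_cons H q (lid ts)) (fmap_cons H e (lid ts)).
  exact: cocontinuous_coequalizer (H_cocont [::] ts) coeq.
have tail_coeq : is_coequalizer (fmap_cons H (idm z) ps)
    (fmap_cons H (idm z) qs) (fmap_cons H (idm z) es).
  exact: IH (multi_cocontinuous_cons H_cocont).
change (is_coequalizer (fmap_cons H p ps) (fmap_cons H q qs)
  (fmap_cons H e es)).
have -> : fmap_cons H e es = fmap_cons H (idm z) es ∘ fmap_cons H e (lid ys).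
  by rewrite fmap_cons_comp comp_idl lcomp_idr.
have [_ _ head_epi] := head_coeq xs.
apply: (diagonal_coequalizer (head_coeq ys) tail_coeq head_epi
  (p2' := fmap_cons H (idm y) ps) (q2' := fmap_cons H (idm y) qs)
  (s1 := fmap_cons H (idm x) ss) (s2 := fmap_cons H s (lid xs)));
  rewrite !fmap_cons_comp ?comp_idl ?comp_idr ?lcomp_idl ?lcomp_idr //.
- by congr fmap_cons.
- by congr fmap_cons.
- by rewrite ps1.
- by rewrite qs1.
- by rewrite epq (lreflexive_eq hpqs).
Qed.

Lemma multi_cocontinuous_reflexive_coequalizer (C D : Category)
    (H : Functor (SeqCat C) D) (xs ys zs : seq C) (ps qs : lhom xs ys)
    (es : lhom ys zs) :
  multi_cocontinuous H -> lreflexive_coequalizer ps qs es ->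
  reflexive_coequalizer (lfmap H ps) (lfmap H qs) (lfmap H es).
Proof.
move=> H_cocont hpqs; split; last exact: multi_cocontinuous_coequalizer.
have [ss [pss qss]] := lreflexive_section hpqs.
exists (lfmap H ss); split; rewrite -(fmap_comp H) ?pss ?qss; exact: lfmap_id.
Qed.

(** * Monadic adjunctions *)

Lemma algebra_eq (C : Category) (M : Monad C) (x y : Algebra M) :
  alg_ob x = alg_ob y -> alg_act x ≈ alg_act y -> x = y.
Proof.
case: x y => [x a u m] [y b u' m'] /= exy; subst y => /heq_eq eab; subst b.
by f_equal; apply: proof_irrelevance.
Qed.

Lemma alg_act_heq (C : Category) (M : Monad C) (x y : Algebra M) :
  x = y -> alg_act x ≈ alg_act y.
Proof. by move=> ->; apply: heq_refl. Qed.

Section Adjunction.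
Variables (C D : Category) (F : Functor D C) (U : Functor C D).
Variable adj : Adjunction F U.

Lemma counit_nat (x y : C) (f : hom x y) :
  adj_counit adj y ∘ fmap F (fmap U f) = f ∘ adj_counit adj x.
Proof. exact: (nt_nat (adj_counit adj)). Qed.

Lemma unit_nat (x y : D) (f : hom x y) :
  adj_unit adj y ∘ f = fmap U (fmap F f) ∘ adj_unit adj x.
Proof. exact: (nt_nat (adj_unit adj)). Qed.

Lemma transposeK x y (f : hom (F x) y) :
  adj_counit adj y ∘ fmap F (fmap U f ∘ adj_unit adj x) = f.
Proof.
by rewrite fmap_comp comp_assoc counit_nat -comp_assoc adj_triangleF comp_idr.
Qed.

Lemma left_adjoint_cocontinuous : preserves_colimits F.
Proof.
move=> J H c hc c'.
have transposed_leg_nat (i j : J) (f : hom i j) :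
    fmap U (leg c' j) ∘ adj_unit adj (H j) ∘ fmap H f =
    fmap U (leg c' i) ∘ adj_unit adj (H i).
  rewrite -comp_assoc unit_nat comp_assoc -fmap_comp.
  by rewrite [leg c' j ∘ _](leg_nat c').
have [h [hleg uniq]] := hc (MkCocone transposed_leg_nat).
exists (adj_counit adj _ ∘ fmap F h); split=> [j|g gleg].
  by rewrite /= -comp_assoc -fmap_comp hleg transposeK.
rewrite (uniq (fmap U g ∘ adj_unit adj _)) ?transposeK // => j /=.
by rewrite -comp_assoc unit_nat comp_assoc -fmap_comp -gleg.
Qed.

Hypothesis hmon : monadic adj.

Lemma monadic_faithful : faithful U.
Proof.
by move=> x y f g e; apply: (invertible_faithful hmon); apply: alg_hom_ext.
Qed.

Lemma monadic_full (x y : C) (c : hom (U x) (U y)) :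
  c ∘ fmap U (adj_counit adj x) =
    fmap U (adj_counit adj y) ∘ fmap U (fmap F c) ->
  exists g : hom x y, fmap U g = c.
Proof.
move=> cP; have [g gE] := invertible_full hmon
  (@MkAlgHom D (adj_monad adj) (comparison adj x) (comparison adj y) c cP).
by exists g; apply: (f_equal (@alg_hom _ _ _ _) gE).
Qed.

Lemma counit_coequalizer (x : C) :
  reflexive_coequalizer (fmap F (fmap U (adj_counit adj x)))
    (adj_counit adj (F (U x))) (adj_counit adj x).
Proof.
split.
  exists (fmap F (adj_unit adj (U x))); split; last exact: adj_triangleF.
  by rewrite -fmap_comp adj_triangleU fmap_id.
split=> [|z f fpq|z g g' gg']; first exact: counit_nat.
- have fU : fmap U f ∘ adj_unit adj (U x) ∘ fmap U (adj_counit adj x) =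
      fmap U f.
    rewrite -comp_assoc unit_nat comp_assoc -fmap_comp fpq fmap_comp.
    by rewrite -comp_assoc adj_triangleU comp_idr.
  have [|g gE] := @monadic_full x z (fmap U f ∘ adj_unit adj (U x)).
    by rewrite fU -fmap_comp transposeK.
  by exists g; apply: monadic_faithful; rewrite fmap_comp gE.
- have transpose k :
      fmap U (k ∘ adj_counit adj x) ∘ adj_unit adj (U x) = fmap U k.
    by rewrite fmap_comp -comp_assoc adj_triangleU comp_idr.
  by apply: monadic_faithful; rewrite -!transpose gg'.
Qed.

End Adjunction.

Lemma iso_monadic (C D : Category) (K : CatIso C D) :
  monadic (iso_adjunction K).
Proof.
have K_inv := iso_inv K; apply: invertible_of_bijective.
- move=> x y f g e; apply: (invertible_faithful K_inv).
  exact: (f_equal (@alg_hom _ _ _ _) e).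
- move=> x y g; have [f fE] := invertible_full K_inv (alg_hom g).
  by exists f; apply: alg_hom_ext.
- move=> x y e; apply: (invertible_inj K_inv).
  exact: (f_equal (@alg_ob _ _) e).
- move=> w; exists (inverse (iso_inv K) (alg_ob w)).
  have ob_w : K (inverse (iso_inv K) (alg_ob w)) = alg_ob w.
    exact: ob_inverse.
  apply: algebra_eq => //.
  have unit_id : mnd_eta (adj_monad (iso_adjunction K)) (alg_ob w) ≈
      idm (alg_ob w) by exact: eq_hom_heq.
  have act_id : alg_act w ≈ idm (alg_ob w).
    by rewrite -(alg_unit w); apply/heq_sym/(heq_idr _ unit_id).
  apply: heq_trans (heq_sym act_id).
  apply: heq_trans (heq_fmap_id K (eq_hom_heq _ (inverse_ob _ _))) _.
  exact: heq_idm.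
Qed.

(** * The lax functor [U] from [E] to [U E F] *)

Section LaxUEF.
Variables (V W : Category) (F : Functor W V) (U : Functor V W).
Variables (adj : Adjunction F U) (E : Multitensor V).
Let D := UEF adj E.
Let eps := adj_counit adj.

Fixpoint lcounit (vs : seq V) : lhom (map F (map U vs)) vs :=
  if vs is v :: vs' then (eps v, lcounit vs') else tt.

Fixpoint llcounit (vss : seq (seq V)) :
    @lhom (SeqCat V) (map (map F) (map (map U) vss)) vss :=
  if vss is vs :: vss' then (lcounit vs, llcounit vss') else tt.

Lemma lcounit_nat (vs vs' : seq V) (f : lhom vs vs') :
  lcomp (lcounit vs') (lmap F (lmap U f)) = lcomp f (lcounit vs).
Proof.
elim: vs vs' f => [|v vs IH] [|v' vs'] //=; first by case.
by case=> f fs; rewrite /= IH; congr pair; apply: counit_nat.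
Qed.

Lemma lcounit_cat vs vs' :
  lheq (lcat (lcounit vs) (lcounit vs')) (lcounit (vs ++ vs')).
Proof.
elim: vs => [|v vs IH] /=; first exact: heq_refl.
by apply: lheq_cons => //; apply: heq_refl.
Qed.

Lemma lflatten_llcounit vss :
  lheq (lflatten (llcounit vss)) (lcounit (flatten vss)).
Proof.
elim: vss => [|vs vss IH] /=; first exact: heq_refl.
by apply: heq_trans (lcounit_cat _ _); apply: lheq_cat => //; apply: heq_refl.
Qed.

Lemma unit_UEF (x : W) :
  mt_unit D x = fmap U (mt_unit E (F x)) ∘ adj_unit adj x.
Proof. by []. Qed.

Definition UEF_lax_map (vs : seq V) : hom (D (map U vs)) (U (E vs)) :=
  fmap U (lfmap E (lcounit vs)).

Lemma UEF_lax_map_nat vs vs' (f : lhom vs vs') :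
  UEF_lax_map vs' ∘ lfmap D (lmap U f) = fmap U (lfmap E f) ∘ UEF_lax_map vs.
Proof.
rewrite -[LHS](fmap_comp U (lfmap E _) (lfmap E (lmap F (lmap U f)))).
by rewrite -lfmap_comp lcounit_nat lfmap_comp fmap_comp.
Qed.

Lemma UEF_lax_map_unit v :
  UEF_lax_map [:: v] ∘ mt_unit D (U v) = fmap U (mt_unit E v).
Proof.
rewrite unit_UEF /UEF_lax_map comp_assoc -(fmap_comp U).
rewrite -[X in fmap U X]mt_unit_nat fmap_comp -comp_assoc.
by rewrite adj_triangleU comp_idr.
Qed.

Lemma lcounit_llax vss :
  lcomp (lcounit (map E vss)) (lmap F (llax UEF_lax_map vss)) =
  lcomp (lmap E (llcounit vss)) (lcounits adj E (map (map U) vss)).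
Proof. by elim: vss => //= vs vss ->; congr pair; apply: counit_nat. Qed.

Lemma UEF_lax_map_sub vss :
  fmap U (msub E vss) ∘ UEF_lax_map (map E vss) ∘
    lfmap D (llax UEF_lax_map vss) =
  UEF_lax_map (flatten vss) ∘ lfmap D (lcast (flatten_map_map U vss)) ∘
    msub D (map (map U) vss).
Proof.
have lax_sub_E : msub E vss ∘ lfmap E (lcounit (map E vss)) ∘
      lfmap E (lmap F (llax UEF_lax_map vss)) =
    lfmap E (lcounit (flatten vss)) ∘
      lfmap E (lmap F (lcast (flatten_map_map U vss))) ∘
      UEF_sub_E adj E (map (map U) vss).
  rewrite -comp_assoc -lfmap_comp lcounit_llax lfmap_comp comp_assoc msub_nat.
  rewrite /UEF_sub_E !comp_assoc; congr (_ ∘ _ ∘ _); rewrite -!lfmap_comp.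
  congr (lfmap E _); apply: lheq_eq.
  rewrite (lmap_cast _ (f_equal (map F) (flatten_map_map U vss))).
  apply: heq_trans (lflatten_llcounit vss) (heq_sym _).
  exact: heq_trans (heq_castr _ _) (heq_castr _ _).
(* An unbounded rewrite would also unfold [UEF_sub_E]. *)
by have := f_equal (fmap U) lax_sub_E; rewrite 4!(fmap_comp U); apply.
Qed.

Definition UEF_lax : lax_functor E D U :=
  LaxFunctor UEF_lax_map_nat UEF_lax_map_unit UEF_lax_map_sub.

(** * Algebra structures on the homs of [U E F]-categories *)

Lemma UEF_sub_unit (xs : seq W) :
  UEF_sub_E adj E [:: xs] ∘ mt_unit E (F (D xs)) ≈ eps (E (map F xs)).
Proof.
rewrite /UEF_sub_E -!comp_assoc -mt_unit_nat (comp_assoc (msub E _)).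
rewrite [msub E _ ∘ _](mt_unitl E).
exact: heq_trans (heq_lcastl _ _) (heq_lcastl _ _).
Qed.

Fixpoint lmapped_units (xs : seq W) : lhom (map U (map F xs))
    (map D (map (fun x => [:: x]) xs)) :=
  if xs is x :: xs' then (fmap U (mt_unit E (F x)), lmapped_units xs') else tt.

Lemma lcounits_mapped_units xs :
  lheq (lcomp (lcounits adj E (map (fun x => [:: x]) xs))
          (lmap F (lmapped_units xs)))
       (lcomp (lunits (mt_unit E) (map F xs)) (lcounit (map F xs))).
Proof.
elim: xs => [|x xs IH] /=; first exact: heq_refl.
by apply: lheq_cons => //; apply/eq_heq/counit_nat.
Qed.

Lemma UEF_sub_units xs :
  UEF_sub_E adj E (map (fun x => [:: x]) xs) ∘
    lfmap E (lmap F (lmapped_units xs)) ≈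
  lfmap E (lcounit (map F xs)).
Proof.
rewrite /UEF_sub_E -2!comp_assoc -lfmap_comp.
apply: heq_trans (heq_lcastl _ _) _.
have counits := heq_lfmap E (lcounits_mapped_units xs).
have singletons : msub E (map (map F) (map (fun x => [:: x]) xs)) ≈
    msub E (map (fun x => [:: x]) (map F xs)).
  by apply: heq_msub; rewrite -!map_comp.
apply: heq_trans (heq_comp singletons counits) _.
rewrite lfmap_comp comp_assoc [msub E _ ∘ _](mt_unitr E).
exact: heq_lcastl.
Qed.

End LaxUEF.

Section HomAlgebras.
Variables (V W : Category) (F : Functor W V) (U : Functor V W).
Variables (adj : Adjunction F U) (E : Multitensor V).
Let D := UEF adj E.
Let eps := adj_counit adj.
Variable Z : ECategory D.

Definition hom_act (a b : gr_ob Z) :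
    hom (U (F (gr_hom Z a b))) (gr_hom Z a b) :=
  ec_comp Z a [:: b] ∘ fmap U (mt_unit E (F (gr_hom Z a b))).

Fixpoint lhom_acts (a : gr_ob Z) (s : seq (gr_ob Z)) :
    lhom (map U (map F (pairmap (gr_hom Z) a s))) (pairmap (gr_hom Z) a s) :=
  if s is b :: s' then (hom_act a b, lhom_acts b s') else tt.

Lemma ec_comp_hom_act (a : gr_ob Z) s :
  ec_comp Z a s ∘ fmap U (eps (E (map F (pairmap (gr_hom Z) a s)))) =
  hom_act a (last a s) ∘ fmap U (fmap F (ec_comp Z a s)).
Proof.
have assoc := (comp_associativeP (ec_comp Z)).1 (ec_assoc Z) a [:: s].
apply: heq_eq; apply: heq_sym.
rewrite /hom_act -comp_assoc -fmap_comp mt_unit_nat fmap_comp comp_assoc.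
apply: heq_trans (heq_comp assoc (heq_refl _)) _; rewrite -comp_assoc.
apply: heq_comp.
  apply: heq_trans (heq_lcastr _ _) _; apply: heq_compositions => //.
  exact: flatten1.
by rewrite -(fmap_comp U); apply: heq_fmap; apply: UEF_sub_unit.
Qed.

Lemma lhom_actsE (a : gr_ob Z) s
    (p : map D (map (fun x => [:: x]) (pairmap (gr_hom Z) a s)) =
         map D (paths_homs a (map (fun b => [:: b]) s))) :
  lheq (lhom_acts a s)
    (lcomp (lcompositions (ec_comp Z) a (map (fun b => [:: b]) s))
       (lcomp (lcast p) (lmapped_units adj E (pairmap (gr_hom Z) a s)))).
Proof.
elim: s a p => [|b s IH] a p /=; first exact: heq_refl.
have q : map D (map (fun x => [:: x]) (pairmap (gr_hom Z) b s)) =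
    map D (paths_homs b (map (fun b => [:: b]) s)) by case: p.
rewrite (lcast_cons p erefl q) /= comp_idl.
by apply: lheq_cons (IH _ _); apply: heq_refl.
Qed.

Lemma ec_comp_lhom_acts (a : gr_ob Z) s :
  ec_comp Z a s ∘ lfmap D (lhom_acts a s) =
  ec_comp Z a s ∘
    fmap U (lfmap E (lcounit adj (map F (pairmap (gr_hom Z) a s)))).
Proof.
pose hs := pairmap (gr_hom Z) a s; pose ss := map (fun b => [:: b]) s.
have assoc := (comp_associativeP (ec_comp Z)).1 (ec_assoc Z) a ss.
have p := f_equal (map D) (esym (paths_homs_singletons a s)).
have nested : ec_comp Z a s ≈ ec_comp Z a (path_targets a ss).
  by apply: heq_compositions; rewrite // path_targets_singletons.
apply: heq_eq.
apply: heq_trans (heq_comp nested (heq_lfmap D (lhom_actsE p))) _.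
rewrite lfmap_comp comp_assoc.
apply: heq_trans (heq_comp assoc (heq_refl _)) _; rewrite -comp_assoc.
apply: heq_comp.
  apply: heq_trans (heq_lcastr _ _) _; apply: heq_compositions => //.
  exact: flatten_singletons.
have singletons : msub D (paths_homs a ss) ≈ msub D (map (fun x => [:: x]) hs).
  by apply: heq_msub; apply: paths_homs_singletons.
rewrite lfmap_comp; apply: heq_trans (heq_comp singletons (heq_lcastl _ _)) _.
apply: heq_trans (eq_heq (esym (fmap_comp U (UEF_sub_E adj E _) _))) _.
by apply: heq_fmap; apply: UEF_sub_units.
Qed.

Lemma hom_act_unit (a b : gr_ob Z) :
  hom_act a b ∘ adj_unit adj (gr_hom Z a b) = idm (gr_hom Z a b).
Proof. by rewrite /hom_act -comp_assoc -ec_unit. Qed.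

Lemma hom_act_assoc (a b : gr_ob Z) :
  hom_act a b ∘ fmap U (fmap F (hom_act a b)) =
  hom_act a b ∘ fmap U (eps (F (gr_hom Z a b))).
Proof.
rewrite {2}/hom_act (fmap_comp F) (fmap_comp U) comp_assoc.
rewrite -[X in X ∘ _](ec_comp_hom_act a [:: b]) /hom_act -!comp_assoc.
congr (_ ∘ _); rewrite -!fmap_comp; congr (fmap U _).
exact: counit_nat.
Qed.

Definition hom_algebra (a b : gr_ob Z) : EM (adj_monad adj) :=
  @MkAlgebra W (adj_monad adj) (gr_hom Z a b) (hom_act a b)
    (hom_act_unit a b) (hom_act_assoc a b).

End HomAlgebras.

Lemma efunctor_hom_act (V W : Category) (F : Functor W V) (U : Functor V W)
    (adj : Adjunction F U) (E : Multitensor V) (Y Z : ECategory (UEF adj E))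
    (f : EFunctor Y Z) (a b : gr_ob Y) :
  gh_hom f a b ∘ hom_act a b =
  hom_act (gh_ob f a) (gh_ob f b) ∘ fmap U (fmap F (gh_hom f a b)).
Proof.
rewrite /hom_act comp_assoc [gh_hom f a b ∘ _](ef_comp f a [:: b]).
rewrite eq_hom_id comp_idl -!comp_assoc; congr (_ ∘ _).
rewrite -!(fmap_comp U); congr (fmap U _).
exact/esym/mt_unit_nat.
Qed.

(** * [E]-categories are [U E F]-categories *)

Section BaseChangeUEF.
Variables (V W : Category) (F : Functor W V) (U : Functor V W).
Variables (adj : Adjunction F U) (hmon : monadic adj).
Variables (E : Multitensor V) (E_closed : mt_closed E).
Let D := UEF adj E.
Let eps := adj_counit adj.
Let phi := UEF_lax adj E.

Lemma lcounit_coequalizer vs :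
  lreflexive_coequalizer (lmap F (lmap U (lcounit adj vs)))
    (lcounit adj (map F (map U vs))) (lcounit adj vs).
Proof.
elim: vs => [|v vs IH]; first exact: lreflexive_nil.
by apply: lreflexive_cons IH; apply: counit_coequalizer.
Qed.

Lemma lcounit_reflexive_coequalizer vs :
  reflexive_coequalizer (lfmap E (lmap F (lmap U (lcounit adj vs))))
    (lfmap E (lcounit adj (map F (map U vs)))) (lfmap E (lcounit adj vs)).
Proof.
exact: multi_cocontinuous_reflexive_coequalizer (lcounit_coequalizer vs).
Qed.

Lemma lcounits_coequalizer xss : exists ys (ps qs : lhom ys _),
  lreflexive_coequalizer ps qs (lcounits adj E xss).
Proof.
elim: xss => [|xs xss [ys [ps [qs IH]]]].
  by exists [::], tt, tt; apply: lreflexive_nil.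
by do 3!eexists; apply: lreflexive_cons (counit_coequalizer hmon _) IH.
Qed.

Lemma llcounit_coequalizer vss : exists ys (ps qs : lhom ys _),
  lreflexive_coequalizer ps qs (lmap E (llcounit adj vss)).
Proof.
elim: vss => [|vs vss [ys [ps [qs IH]]]].
  by exists [::], tt, tt; apply: lreflexive_nil.
by do 3!eexists; apply: lreflexive_cons (lcounit_reflexive_coequalizer vs) IH.
Qed.

Lemma UEF_lax_epic : lax_epic phi.
Proof.
move=> vs v k k' e; have [_ [_ _ epi]] := lcounit_reflexive_coequalizer vs.
by apply: epi; apply: (monadic_faithful hmon); rewrite !fmap_comp.
Qed.

Lemma UEF_lax_epic_nested : lax_epic_nested phi.
Proof.
move=> vss v k k' e.
have [ys [ps [qs coeq_ll]]] := llcounit_coequalizer vss.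
have [zs [ps' [qs' coeq_l]]] := lcounits_coequalizer (map (map U) vss).
have [_ _ epi_ll] := multi_cocontinuous_coequalizer coeq_ll E_closed.
have [_ _ epi_l] := multi_cocontinuous_coequalizer coeq_l E_closed.
have laxE : lfmap E (lcounit adj (map E vss)) ∘
      lfmap E (lmap F (llax phi vss)) =
    lfmap E (lmap E (llcounit adj vss)) ∘
      lfmap E (lcounits adj E (map (map U) vss)).
  by rewrite -lfmap_comp lcounit_llax lfmap_comp.
apply: (epic_comp epi_ll epi_l); rewrite -laxE.
by apply: (monadic_faithful hmon); rewrite !(fmap_comp U).
Qed.

(** The list [map U vs] appears as [ys] because the two are equal only up to a
    cast when [ys] comes from a path in a [UEF]-category. *)
Lemma UEF_lax_factor vs v ys (acts : lhom (map U (map F ys)) ys)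
    (c : hom (D ys) (U v)) :
  map U vs = ys -> lheq acts (lmap U (lcounit adj vs)) ->
  c ∘ fmap U (eps (E (map F ys))) = fmap U (eps v) ∘ fmap U (fmap F c) ->
  c ∘ lfmap D acts = c ∘ fmap U (lfmap E (lcounit adj (map F ys))) ->
  exists k : hom (E vs) v, fmap U k ∘ phi vs ≈ c.
Proof.
move=> ysE; subst ys => /lheq_eq -> c_alg c_acts.
have [g gE] := monadic_full hmon c_alg.
have [_ [_ fact _]] := lcounit_reflexive_coequalizer vs.
have [|k kE] := fact v g.
  by apply: (monadic_faithful hmon); rewrite !(fmap_comp U) gE.
by exists k; apply: eq_heq; rewrite -gE -kE fmap_comp.
Qed.

Lemma base_change_unary_unit (X : Graph V) (c : compositions E X) a b :
  base_change_comp phi c a [:: b] ∘ fmap U (mt_unit E (F (U (gr_hom X a b)))) =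
  fmap U (c a [:: b] ∘ mt_unit E (gr_hom X a b) ∘ eps (gr_hom X a b)).
Proof.
rewrite base_change_unary -!comp_assoc -(fmap_comp U) -(fmap_comp U).
by rewrite mt_unit_nat.
Qed.

Lemma hom_act_base_change (X : ECategory E) (a b : gr_ob X) :
  hom_act (Z := base_change_ob phi X) a b = fmap U (eps (gr_hom X a b)).
Proof. by rewrite /hom_act base_change_unary_unit ec_unit comp_idl. Qed.

Lemma hom_algebra_base_change (X : ECategory E) (a b : gr_ob X) :
  hom_algebra (Z := base_change_ob phi X) a b = comparison adj (gr_hom X a b).
Proof. by apply: algebra_eq => //; apply/eq_heq/hom_act_base_change. Qed.

Definition hom_algebra_graph (Z : ECategory D) : Graph V :=
  MkGraph (fun a b : gr_ob Z => inverse hmon (hom_algebra a b)).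

Lemma hom_algebra_graph_base_change (X : ECategory E) :
  hom_algebra_graph (base_change_ob phi X) = ec_graph X.
Proof.
apply: graph_eq => a b; rewrite hom_algebra_base_change; exact: inverse_ob.
Qed.

Lemma base_change_UEF_full : full (base_change phi).
Proof.
move=> X Y f.
have f_alg (a b : gr_ob X) : gh_hom f a b ∘ fmap U (eps (gr_hom X a b)) =
    fmap U (eps (gr_hom Y (gh_ob f a) (gh_ob f b))) ∘
      fmap U (fmap F (gh_hom f a b)).
  rewrite -!hom_act_base_change; exact: (efunctor_hom_act f).
pose g : GraphHom X Y :=
  @MkGraphHom V X Y (gh_ob f)
    (fun a b => witness (monadic_full hmon (f_alg a b))).
have gE : map_graph_hom U g = f.
  apply: graph_hom_eq => a b; exact: (witnessP (monadic_full hmon (f_alg a b))).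
have g_comp : preserves_comp (ec_comp X) (ec_comp Y) g.
  apply: (preserves_of_base_change UEF_lax_epic); rewrite gE.
  exact: (ef_comp f).
by exists (@MkEFunctor V E X Y g g_comp); apply: efunctor_ext.
Qed.

Lemma base_change_UEF_inj : injective (base_change phi).
Proof.
move=> X Y e; have eq_graph : ec_graph X = ec_graph Y.
  by rewrite -!hom_algebra_graph_base_change [base_change_ob phi X]e.
case: X Y e eq_graph => [g c u m] [g' c' u' m'] e /= eq_g; subst g'.
have cE : c = c' := base_change_comp_inj UEF_lax_epic (ecategory_comp_inj e).
by apply: ecategory_eq => a s; rewrite cE.
Qed.

Section Descent.
Variables (X : Graph V) (c : compositions D (map_graph U X)).
Hypotheses (c_unital : comp_unital c) (c_assoc : comp_associative c).
Let Z := MkECategory c_unital c_assoc.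
Hypothesis c_act : forall a b,
  hom_act (Z := Z) a b = fmap U (eps (gr_hom X a b)).

Lemma lhom_acts_lcounit (a : gr_ob X) s :
  lheq (lhom_acts (Z := Z) a s)
    (lmap U (lcounit adj (pairmap (gr_hom X) a s))).
Proof.
elim: s a => [|b s IH] a /=; first exact: heq_refl.
by apply: lheq_cons (IH _); apply/eq_heq/c_act.
Qed.

Lemma descended_comp_exists (a : gr_ob X) s :
  exists k : hom (E (pairmap (gr_hom X) a s)) (gr_hom X a (last a s)),
    fmap U k ∘ phi _ ≈ c a s.
Proof.
apply: UEF_lax_factor (lhom_acts_lcounit a s) _ _.
- exact/esym/pairmap_map_graph.
- by rewrite -c_act; apply: (ec_comp_hom_act (Z := Z)).
- exact: (ec_comp_lhom_acts (Z := Z)).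
Qed.

Let k : compositions E X := fun a s => witness (descended_comp_exists a s).

Lemma base_change_descended_comp : base_change_comp phi k = c.
Proof.
do 2![apply: functional_extensionality_dep => ?]; apply: heq_eq.
apply: heq_trans (base_change_comp_heq _ _ _ _) _.
exact: (witnessP (descended_comp_exists _ _)).
Qed.

Lemma descended_comp_unital : comp_unital k.
Proof.
move=> a b; have [_ [_ _ epi]] := counit_coequalizer hmon (gr_hom X a b).
apply: epi; apply: (monadic_faithful hmon).
by rewrite -base_change_unary_unit base_change_descended_comp comp_idl -c_act.
Qed.

Lemma descended_comp_assoc : comp_associative k.
Proof.
apply: (associative_of_base_change UEF_lax_epic_nested).
by rewrite base_change_descended_comp.
Qed.

Lemma descent : exists Y : ECategory E, base_change_ob phi Y = Z.
Proof.
exists (MkECategory descended_comp_unital descended_comp_assoc).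
apply: ecategory_eq => a s /=; by rewrite base_change_descended_comp.
Qed.

End Descent.

Lemma base_change_UEF_surj (Z : ECategory D) :
  exists X, base_change_ob phi X = Z.
Proof.
have [h ob_eq act_eq] : exists2 h : gr_ob Z -> gr_ob Z -> V,
    (fun a b => U (h a b)) = gr_hom Z &
    forall a b, hom_act a b ≈ fmap U (eps (h a b)).
  exists (fun a b => inverse hmon (hom_algebra a b)).
    do 2![apply: functional_extensionality => ?].
    exact: (f_equal (@alg_ob W (adj_monad adj))
      (ob_inverse hmon (hom_algebra _ _))).
  move=> a b; apply: heq_sym.
  exact: (alg_act_heq (ob_inverse hmon (hom_algebra a b))).
case: Z h ob_eq act_eq => [[o hZ] c u m] /= h ob_eq act_eq; subst hZ.
by apply: (descent (X := MkGraph h)) => a b; apply/heq_eq/act_eq.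
Qed.

Lemma base_change_UEF_invertible : invertible (base_change phi).
Proof.
exact: invertible_of_bijective
  (base_change_faithful (phi := phi) (monadic_faithful hmon))
  base_change_UEF_full base_change_UEF_inj base_change_UEF_surj.
Qed.

End BaseChangeUEF.

(** * The transported multitensor is lifted *)

Section NormalMultitensor.
Variables (V : Category) (E : Multitensor V) (E_normal : mt_normal E).

Lemma normal_functor : E ⊚ singleton V = functor_id V.
Proof. exact: (f_equal (@projT1 _ _) E_normal). Qed.

Lemma normal_fmap (x y : V) (f : hom x y) :
  @lfmap _ _ E [:: x] [:: y] (f, tt) ≈ f.
Proof. exact: eq_functor_map f normal_functor. Qed.

Lemma normal_unit_heq (x : V) : mt_unit E x ≈ idm x.
Proof. by have [p ->] := normal_unit E_normal x; apply: eq_hom_heq. Qed.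

Lemma normal_unary_comp (X : ECategory E) a b :
  ec_comp X a [:: b] ≈ idm (gr_hom X a b).
Proof.
apply: heq_trans (heq_sym (heq_idr _ (normal_unit_heq _))) _.
by rewrite ec_unit; apply: heq_refl.
Qed.

End NormalMultitensor.

Lemma normal_intro (V : Category) (E : Multitensor V) :
  E ⊚ singleton V = functor_id V ->
  (forall x, mt_unit E x ≈ idm x) -> mt_normal E.
Proof.
rewrite /mt_normal; move: (mt_unit E); move: (E ⊚ singleton V) => T u e.
by subst T => h; congr existT; apply: nt_ext => x; apply: heq_eq.
Qed.

(** [EM M] and [EM (adj_monad adj)] are only provably equal in the case of
    interest, so [K] cannot be compared with [comparison adj] itself. *)
Record is_comparison (V W : Category) (F : Functor W V) (U : Functor V W)
    (adj : Adjunction F U) (M : Monad W) (K : Functor V (EM M)) : Prop :=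
  IsComparison {
  comparison_ob : forall v, alg_ob (K v) = U v;
  comparison_map : forall v v' (f : hom v v'), alg_hom (fmap K f) ≈ fmap U f;
  comparison_act : forall v, alg_act (K v) ≈ fmap U (adj_counit adj v)
}.

Lemma comparison_isoP (V W : Category) (F : Functor W V) (U : Functor V W)
    (adj : Adjunction F U) (hmon : monadic adj) (E : Multitensor V)
    (E_normal : mt_normal E) : is_comparison adj (comparison_iso hmon E_normal).
Proof.
rewrite /comparison_iso; move: (UEF_monad adj E_normal) => e.
by move: (mt_monad _) e => M e; subst M; split=> //= *; apply: heq_refl.
Qed.

Lemma alg_hom_heq (C : Category) (M : Monad C) (a b a' b' : EM M)
    (f : hom a b) (f' : hom a' b') :
  a = a' -> b = b' -> alg_hom f ≈ alg_hom f' -> f ≈ f'.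
Proof. by move=> ea eb; subst => /heq_eq e; apply/eq_heq/alg_hom_ext. Qed.

Lemma graph_hom_heq (V : Category) (o o' : SmallType) (h k : o -> o -> V)
    (h' k' : o' -> o' -> V) (f : o -> o')
    (g : forall a b, hom (h a b) (h' (f a) (f b)))
    (g' : forall a b, hom (k a b) (k' (f a) (f b))) :
  (forall a b, h a b = k a b) -> (forall a b, h' a b = k' a b) ->
  (forall a b, g a b ≈ g' a b) ->
  @heq (GraphCat V) (MkGraph h) (MkGraph h') (MkGraph k) (MkGraph k')
    (@MkGraphHom V (MkGraph h) (MkGraph h') f g)
    (@MkGraphHom V (MkGraph k) (MkGraph k') f g').
Proof.
move=> hk hk'.
have ? : h = k by do 2![apply: functional_extensionality => ?].
have ? : h' = k' by do 2![apply: functional_extensionality => ?].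
by subst => eg; apply/eq_heq/graph_hom_ext => a b; apply: heq_eq.
Qed.

Section TransportLifted.
Variables (V W : Category) (F : Functor W V) (U : Functor V W).
Variables (adj : Adjunction F U) (E : Multitensor V) (E_normal : mt_normal E).
Let D := UEF adj E.
Variable K : CatIso V (EM (mt_monad D)).
Hypothesis K_comparison : is_comparison adj K.

Lemma unary_base_change (X : ECategory E) a b :
  gr_hom (ecat_algebra_graph (base_change_ob (UEF_lax adj E) X)) a b =
  K (gr_hom X a b).
Proof.
apply: algebra_eq; first by rewrite (comparison_ob K_comparison).
apply: heq_trans (heq_sym (comparison_act K_comparison _)).
rewrite /= base_change_unary.
apply: heq_trans (heq_idl _ (heq_fmap_id U (normal_unary_comp E_normal a b))) _.
by apply: heq_fmap; apply: normal_fmap.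
Qed.

Lemma ecat_algebras_base_change :
  ecat_algebras D ⊚ base_change (UEF_lax adj E) =
  graph_functor K ⊚ ecat_graph E.
Proof.
apply: functor_eq => [X|X Y f].
  by apply: (graph_eq (X := map_graph K X)) => a b; apply: unary_base_change.
apply: graph_hom_heq => a b; try exact: unary_base_change.
apply: alg_hom_heq; try exact: unary_base_change.
exact/heq_sym/(comparison_map K_comparison).
Qed.

Lemma transport_ecat_iso : monadic adj -> mt_closed E ->
  exists Phi : CatIso (ECat (transport K E)) (ECat D),
    ecat_algebras D ⊚ Phi = ecat_graph (transport K E).
Proof.
move=> hmon E_closed.
pose Phi_U := MkCatIso (base_change_UEF_invertible hmon E_closed).
pose Phi_K := MkCatIso (base_change_UEF_invertible (iso_monadic K) E_closed).
exists (iso_comp Phi_U (iso_sym Phi_K)); rewrite /= functor_compA.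
rewrite ecat_algebras_base_change.
rewrite -(ecat_graph_base_change (UEF_lax (iso_adjunction K) E)).
by rewrite -functor_compA (Kinverse (iso_inv Phi_K)) functor_comp_idr.
Qed.

End TransportLifted.

Lemma iso_cocontinuous (C D : Category) (K : CatIso C D) : preserves_colimits K.
Proof. exact: (left_adjoint_cocontinuous (iso_adjunction (iso_sym K))). Qed.

Lemma comp_cocontinuous (A B C : Category) (G : Functor B C) (F : Functor A B) :
  preserves_colimits F -> preserves_colimits G -> preserves_colimits (G ⊚ F).
Proof.
move=> hF hG J H c /hF /hG hc c'.
exact: (hc (@MkCocone _ _ (G ⊚ (F ⊚ H)) (apex c') (leg c') (leg_nat c'))).
Qed.

Lemma lmap_slot (C D : Category) (L : Functor C D) (l r : seq C) (x y : C)
    (f : hom x y) :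
  lheq (lmap L (fmap (slot l r) f))
       (fmap (slot (map L l) (map L r)) (fmap L f)).
Proof.
elim: l => [|a l IH] /=; first by rewrite lmap_id; apply: heq_refl.
by rewrite fmap_id; apply: lheq_cons => //; apply: heq_refl.
Qed.

Lemma closed_distributive (V : Category) (E : Multitensor V) :
  mt_closed E -> mt_distributive E.
Proof. by move=> E_closed l r I; apply: E_closed. Qed.

Section Transport.
Variables (C D : Category) (K : CatIso C D) (E : Multitensor C).
Let L := inverse (iso_inv K).

Lemma transport_slot l r :
  transport K E ⊚ slot l r = K ⊚ (E ⊚ slot (map L l) (map L r) ⊚ L).
Proof.
apply: functor_eq => [x|x y f] /=; first by rewrite map_cat.
by do 2!apply: heq_fmap; apply: lmap_slot.
Qed.

Lemma transport_closed : mt_closed E -> mt_closed (transport K E).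
Proof.
move=> E_closed l r; rewrite transport_slot.
apply: comp_cocontinuous; last exact: iso_cocontinuous.
apply: comp_cocontinuous; last exact: E_closed.
exact: (@iso_cocontinuous _ _ (iso_sym K)).
Qed.

Lemma transport_normal : mt_normal E -> mt_normal (transport K E).
Proof.
move=> E_normal; apply: normal_intro => [|x].
  apply: functor_eq => [x|x y f] /=.
    have /= -> := eq_functor_ob (L x) (normal_functor E_normal).
    exact: ob_inverse.
  apply: heq_trans (fmap_inverse (iso_inv K) f); apply: heq_fmap.
  exact: (normal_fmap E_normal (fmap L f)).
apply: heq_trans (heq_castr _ _) _.
apply: heq_trans (heq_fmap_id K (normal_unit_heq E_normal _)) _.
by apply: heq_idm; apply: ob_inverse.
Qed.

End Transport.

Lemma transport_lifted (V W : Category) (F : Functor W V) (U : Functor V W)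
    (adj : Adjunction F U) (hmon : monadic adj) (E : Multitensor V)
    (E_closed : mt_closed E) (E_normal : mt_normal E) :
  is_lifted (UEF adj E) (transport (comparison_iso hmon E_normal) E).
Proof.
split; first exact: transport_normal.
  exact/closed_distributive/transport_closed.
exact: (transport_ecat_iso E_normal (comparison_isoP hmon E_normal)).
Qed.

(** * Initial objects *)

Definition initial (C : Category) (x : C) :=
  forall y, exists f : hom x y, forall g, g = f.

Lemma initial_eq (C : Category) (x y : C) (f g : hom x y) : initial x -> f = g.
Proof. by move=> /(_ y) [h u]; rewrite (u f) (u g). Qed.

Lemma initial_heq (C : Category) (x y y' : C) (f : hom x y) (g : hom x y') :
  initial x -> y = y' -> f ≈ g.
Proof. by move=> hx ?; subst; apply/eq_heq/initial_eq. Qed.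

Program Definition empty_functor (C : Category) :
    Functor (discrete Empty_set) C :=
  @MkFunctor (discrete Empty_set) C
    (fun i : Empty_set => match i with end)
    (fun i : Empty_set => match i with end) _ _.
Next Obligation. by move=> C []. Qed.
Next Obligation. by move=> C []. Qed.

Program Definition empty_cocone (C : Category)
    (D : Functor (discrete Empty_set) C) (x : C) : Cocone D :=
  @MkCocone _ C D x (fun j : Empty_set => match j with end) _.
Next Obligation. by move=> C D x []. Qed.

Lemma initial_colimitP (C : Category) (D : Functor (discrete Empty_set) C)
    (c : Cocone D) : is_colimit c <-> initial (apex c).
Proof.
split=> [hc y | h c'].
  have [f [_ u]] := hc (empty_cocone D y).
  by exists f => g; apply/esym/u; case.
by have [f u] := h (apex c'); exists f; split=> [[]|g _]; first apply/esym/u.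
Qed.

Lemma preserves_initial (C D : Category) (G : Functor C D) (x : C) :
  preserves_coproducts G -> initial x -> initial (G x).
Proof.
move=> hG /(initial_colimitP (empty_cocone (empty_functor C) x)).2.
by move=> /(hG _ _ _) /initial_colimitP.
Qed.

Lemma cocomplete_initial (C : Category) :
  cocomplete C -> exists x : C, initial x.
Proof.
move=> hC; have [c /initial_colimitP hc] := hC _ (empty_functor C).
by exists (apex c).
Qed.

Lemma distributive_initial (V : Category) (E : Multitensor V) (xs : seq V) :
  mt_distributive E -> List.Exists (@initial V) xs -> initial (E xs).
Proof.
move=> hE hxs; have [x [x_in hx]] := (List.Exists_exists _ _).1 hxs.
have [l [r ->]] := List.in_split _ _ x_in.
exact: (preserves_initial (hE l r) hx).
Qed.

Lemma Exists_initial_flatten (V : Category) (E : Multitensor V)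
    (xss : seq (seq V)) : mt_distributive E ->
  List.Exists (@initial V) (flatten xss) ->
  List.Exists (@initial V) (map E xss).
Proof.
move=> hE; elim: xss => [|xs xss IH] //= h.
have [hxs|/IH] := (List.Exists_app _ _ _).1 h.
  by apply: List.Exists_cons_hd; apply: distributive_initial.
exact: List.Exists_cons_tl.
Qed.

(** * Free categories on a path *)

(** The free [Q]-category on a path with steps [xs]; the composite of the path
    identifies the hom between its endpoints with [Q xs]. *)
Record free_path (A : Category) (Q : Multitensor A) (xs : seq A) := FreePath {
  fp_cat :> ECategory Q;
  fp_source : gr_ob fp_cat;
  fp_targets : seq (gr_ob fp_cat);
  fp_gens : lhom xs (pairmap (gr_hom fp_cat) fp_source fp_targets);
  fp_inv : hom (gr_hom fp_cat fp_source (last fp_source fp_targets)) (Q xs);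
  fp_compK :
    fp_inv ∘ (ec_comp fp_cat fp_source fp_targets ∘ lfmap Q fp_gens) =
    idm (Q xs);
  fp_invK :
    ec_comp fp_cat fp_source fp_targets ∘ lfmap Q fp_gens ∘ fp_inv = idm _;
  fp_extend : forall (Y : ECategory Q) b t
      (h : lhom xs (pairmap (gr_hom Y) b t)),
    exists R : EFunctor fp_cat Y,
      [/\ gh_ob R fp_source = b, map (gh_ob R) fp_targets = t
        & lheq (lcomp (path_map R fp_source fp_targets) fp_gens) h]
}.

Section FreeLine.
Variables (A : Category) (Q : Multitensor A) (Q_distr : mt_distributive Q).
Variables (zero : A) (zero_initial : initial zero) (x : nat -> A).

(** For [j < i] the value is a list that [Q] sends to an initial object. *)
Definition segment (i j : nat) : seq A :=
  if i <= j then map x (iota i (j - i)) else [:: zero].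

Lemma segmentD i k : segment i (i + k) = map x (iota i k).
Proof. by rewrite /segment leq_addr addKn. Qed.

Lemma segment_cat i j k :
  i <= j -> j <= k -> segment i j ++ segment j k = segment i k.
Proof.
move=> /subnKC <- /subnKC <-; set p := j - i; set q := k - _.
by rewrite !segmentD -addnA segmentD iotaD map_cat.
Qed.

Definition line_graph : Graph A := MkGraph (fun i j => Q (segment i j)).

Lemma pairmap_line_graph i s :
  pairmap (gr_hom line_graph) i s = map Q (pairmap segment i s).
Proof. by elim: s i => //= j s IH i; rewrite IH. Qed.

Lemma path_leq_last i s : path leq i s -> i <= last i s.
Proof. by elim: s i => //= j s IH i /andP [ij /IH]; apply: leq_trans. Qed.

Lemma flatten_segments i s : path leq i s ->
  flatten (pairmap segment i s) = segment i (last i s).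
Proof.
elim: s i => [|j s IH] i /=; first by rewrite /segment leqnn subnn.
by case/andP=> ij js; rewrite IH // segment_cat // path_leq_last.
Qed.

Lemma line_hom_initial i j : j < i -> initial (gr_hom line_graph i j).
Proof.
rewrite ltnNge /= /segment => /negbTE ->.
by apply: distributive_initial => //; apply: List.Exists_cons_hd.
Qed.

Lemma nonmonotone_path_initial i s : ~~ path leq i s ->
  List.Exists (@initial A) (pairmap (gr_hom line_graph) i s).
Proof.
elim: s i => //= j s IH i; rewrite negb_and -ltnNge => /orP [ji|/IH].
  by apply: List.Exists_cons_hd; apply: line_hom_initial.
exact: List.Exists_cons_tl.
Qed.

Lemma line_comp_exists i s :
  exists c : hom (Q (pairmap (gr_hom line_graph) i s))
      (Q (segment i (last i s))),
    path leq i s -> c ≈ msub Q (pairmap segment i s).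
Proof.
have [mono|/nonmonotone_path_initial h] := boolP (path leq i s); last first.
  have [c _] := distributive_initial Q_distr h (Q (segment i (last i s))).
  by exists c.
exists (lfmap Q (lcast (flatten_segments mono)) ∘ msub Q _ ∘
  lfmap Q (lcast (pairmap_line_graph i s))) => _.
exact: heq_trans (heq_lcastr _ _) (heq_lcastl _ _).
Qed.

Definition line_comp : compositions Q line_graph :=
  fun i s => witness (line_comp_exists i s).

Lemma line_compE i s :
  path leq i s -> line_comp i s ≈ msub Q (pairmap segment i s).
Proof. exact: (witnessP (line_comp_exists i s)). Qed.

Lemma line_comp_unital : comp_unital line_comp.
Proof.
move=> i j; case: (leqP i j) => [ij|/line_hom_initial]; last exact: initial_eq.
have compE : line_comp i [:: j] ≈ msub Q [:: segment i j].
  by apply: (@line_compE i [:: j]); rewrite /= ij.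
apply: heq_eq; apply: heq_trans (heq_comp compE (heq_refl _)) _.
by rewrite [_ ∘ _](mt_unitl Q); apply: lfmap_cast_heq.
Qed.

Fixpoint path_segments i (ss : seq (seq nat)) : seq (seq (seq A)) :=
  if ss is s :: ss' then pairmap segment i s :: path_segments (last i s) ss'
  else [::].

Lemma flatten_path_segments i ss :
  flatten (path_segments i ss) = pairmap segment i (flatten ss).
Proof. by elim: ss i => //= s ss IH i; rewrite IH pairmap_cat. Qed.

Lemma paths_homs_line i ss :
  paths_homs (X := line_graph) i ss = map (map Q) (path_segments i ss).
Proof. by elim: ss i => //= s ss IH i; rewrite IH (pairmap_line_graph i s). Qed.

Lemma map_flatten_segments i ss : path leq i (flatten ss) ->
  map flatten (path_segments i ss) =
  pairmap segment i (path_targets (X := line_graph) i ss).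
Proof.
elim: ss i => //= s ss IH i; rewrite cat_path => /andP [mono monos].
by rewrite flatten_segments // IH.
Qed.

Lemma path_targets_monotone i ss : path leq i (flatten ss) ->
  path leq i (path_targets (X := line_graph) i ss).
Proof.
elim: ss i => //= s ss IH i; rewrite cat_path => /andP [mono monos].
by rewrite path_leq_last //= IH.
Qed.

Lemma lcompositions_line i ss : path leq i (flatten ss) ->
  lheq (lcompositions line_comp i ss) (lsubs (msub Q) (path_segments i ss)).
Proof.
elim: ss i => [|s ss IH] i /=; first by move=> _; apply: heq_refl.
rewrite cat_path => /andP [mono monos].
by apply: lheq_cons (IH _ monos); apply: line_compE.
Qed.

Lemma line_comp_assoc : comp_associative line_comp.
Proof.
apply/comp_associativeP => i ss.
have [mono|nonmono] := boolP (path leq i (flatten ss)); last first.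
  apply: initial_heq; last by rewrite -last_path_targets.
  apply/distributive_initial/(Exists_initial_flatten Q_distr) => //.
  by rewrite flatten_paths_homs; apply: nonmonotone_path_initial.
have outer : line_comp i (path_targets (X := line_graph) i ss) ≈
    msub Q (map flatten (path_segments i ss)).
  by rewrite map_flatten_segments //; apply/line_compE/path_targets_monotone.
apply: heq_trans (heq_comp outer (heq_lfmap Q (lcompositions_line mono))) _.
rewrite msub_assoc -!comp_assoc; apply: heq_trans (heq_lcastl _ _) _.
rewrite !comp_assoc; apply: heq_comp_lcast; apply: heq_sym.
  apply: heq_trans (line_compE mono) _; apply: heq_msub.
  by rewrite flatten_path_segments.
by apply: heq_msub; apply: paths_homs_line.
Qed.

Definition line_ecat : ECategory Q :=
  MkECategory line_comp_unital line_comp_assoc.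

Section Extension.
Variables (Y : ECategory Q) (y : nat -> gr_ob Y).
Variable h : forall i, hom (x i) (gr_hom Y (y i) (y i.+1)).

Fixpoint lgens i k : lhom (map x (iota i k))
    (pairmap (gr_hom Y) (y i) (map y (iota i.+1 k))) :=
  if k is k'.+1 then (h i, lgens i.+1 k') else tt.

Lemma last_map_iota i k : last (y i) (map y (iota i.+1 k)) = y (i + k).
Proof. by elim: k i => [|k IH] i /=; rewrite ?addn0 // IH addnS. Qed.

Lemma lgensD i k l :
  lheq (lgens i (k + l)) (lcat (lgens i k) (lgens (i + k) l)).
Proof.
elim: k i => [|k IH] i /=; first by rewrite addn0; apply: heq_refl.
apply: lheq_cons; first exact: heq_refl.
by rewrite -addSnnS; apply: IH.
Qed.

Lemma extension_hom_exists i j :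
  exists r : hom (Q (segment i j)) (gr_hom Y (y i) (y j)),
    forall k, j = i + k ->
      r ≈ ec_comp Y (y i) (map y (iota i.+1 k)) ∘ lfmap Q (lgens i k).
Proof.
have [ij|ji] := leqP i j; last first.
  have [r _] := line_hom_initial ji (gr_hom Y (y i) (y j)).
  by exists r => k jE; exfalso; move: ji; rewrite jE ltnNge leq_addr.
have [k ->] : exists k, j = i + k by exists (j - i); rewrite subnKC.
exists (eq_hom (f_equal (gr_hom Y (y i)) (last_map_iota i k)) ∘
  ec_comp Y (y i) (map y (iota i.+1 k)) ∘ lfmap Q (lgens i k) ∘
  lfmap Q (lcast (segmentD i k))) => k' /addnI <-.
rewrite -!comp_assoc; apply: heq_trans (heq_castl _ _) _.
by apply: heq_comp (heq_refl _) _; apply: heq_lcastr.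
Qed.

Definition extension_hom i j : hom (Q (segment i j)) (gr_hom Y (y i) (y j)) :=
  witness (extension_hom_exists i j).

Lemma extension_homE i k :
  extension_hom i (i + k) ≈
  ec_comp Y (y i) (map y (iota i.+1 k)) ∘ lfmap Q (lgens i k).
Proof. exact: (witnessP (extension_hom_exists i (i + k))). Qed.

Definition extension_graph : GraphHom line_graph Y :=
  @MkGraphHom A line_graph Y y extension_hom.

(** A monotone path in the line is given by its list [ks] of increments;
    [blocks] cuts the interval that it covers accordingly. *)
Lemma monotone_scanl i s : path leq i s -> exists ks, s = scanl addn i ks.
Proof.
elim: s i => [|j s IH] i /=; first by exists [::].
by case/andP=> ij /IH [ks ->]; exists (j - i :: ks); rewrite /= subnKC.
Qed.

Lemma scanl_monotone i ks : path leq i (scanl addn i ks).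
Proof. by elim: ks i => //= k ks IH i; rewrite leq_addr IH. Qed.

Lemma last_scanl_addn i ks : last i (scanl addn i ks) = i + sumn ks.
Proof. by elim: ks i => [|k ks IH] i /=; rewrite ?addn0 // IH addnA. Qed.

Fixpoint blocks (T : Type) (f : nat -> T) i (ks : seq nat) : seq (seq T) :=
  if ks is k :: ks' then map f (iota i k) :: blocks f (i + k) ks' else [::].

Lemma flatten_blocks (T : Type) (f : nat -> T) i ks :
  flatten (blocks f i ks) = map f (iota i (sumn ks)).
Proof. by elim: ks i => //= k ks IH i; rewrite IH iotaD map_cat. Qed.

Lemma pairmap_segment_scanl i ks :
  pairmap segment i (scanl addn i ks) = blocks x i ks.
Proof. by elim: ks i => //= k ks IH i; rewrite IH segmentD. Qed.

Lemma path_targets_blocks i ks :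
  path_targets (y i) (blocks y i.+1 ks) = map y (scanl addn i ks).
Proof. by elim: ks i => //= k ks IH i; rewrite last_map_iota IH. Qed.

Lemma lgens_blocks_exists i ks :
  exists hs : @lhom (SeqCat A) (blocks x i ks)
      (paths_homs (y i) (blocks y i.+1 ks)),
    lheq (lflatten hs) (lgens i (sumn ks)) /\
    lheq (path_map extension_graph i (scanl addn i ks))
      (lcomp (lcompositions (ec_comp Y) (y i) (blocks y i.+1 ks)) (lmap Q hs)).
Proof.
elim: ks i => [|k ks IH] i /=; first by exists tt; split; apply: heq_refl.
set b := last _ _.
have [hs [flat_hs map_hs]] :
    exists hs : @lhom (SeqCat A) (blocks x (i + k) ks)
        (paths_homs b (blocks y (i + k).+1 ks)),
      lheq (lflatten hs) (lgens (i + k) (sumn ks)) /\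
      lheq (path_map extension_graph (i + k) (scanl addn (i + k) ks))
        (lcomp (lcompositions (ec_comp Y) b (blocks y (i + k).+1 ks))
          (lmap Q hs)).
  by rewrite /b last_map_iota; apply: IH.
exists (lgens i k, hs); split=> /=.
  apply: heq_trans (heq_sym (lgensD _ _ _)).
  by apply: lheq_cat flat_hs; apply: heq_refl.
by apply: lheq_cons map_hs; apply: extension_homE.
Qed.

Lemma extension_preserves :
  preserves_comp (ec_comp line_ecat) (ec_comp Y) extension_graph.
Proof.
apply/preserves_compP => i s.
have [/monotone_scanl [ks ->]|nonmono] := boolP (path leq i s); last first.
  apply: initial_heq; last by rewrite /= last_map.
  exact/distributive_initial/nonmonotone_path_initial.
have [hs [flat_hs map_hs]] := lgens_blocks_exists i ks.
have outer : ec_comp Y (y i) (map y (scanl addn i ks)) ≈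
    ec_comp Y (y i) (path_targets (y i) (blocks y i.+1 ks)).
  by apply: heq_compositions; rewrite // path_targets_blocks.
apply: heq_sym; apply: heq_trans (heq_comp outer (heq_lfmap Q map_hs)) _.
have assoc := (comp_associativeP (ec_comp Y)).1 (ec_assoc Y) (y i)
  (blocks y i.+1 ks).
rewrite lfmap_comp comp_assoc.
apply: heq_trans (heq_comp assoc (heq_refl _)) _.
rewrite -(comp_assoc _ (msub Q _)) msub_nat comp_assoc.
apply: heq_comp.
  rewrite /= last_scanl_addn; apply: heq_trans (heq_sym (extension_homE _ _)).
  apply: heq_comp (heq_lfmap Q flat_hs); apply: heq_trans (heq_lcastr _ _) _.
  by apply: heq_compositions; rewrite // flatten_blocks.
apply: heq_sym; apply: heq_trans (line_compE (scanl_monotone _ _)) _.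
by apply: heq_msub; apply: pairmap_segment_scanl.
Qed.

Definition extension : EFunctor line_ecat Y :=
  @MkEFunctor A Q line_ecat Y extension_graph extension_preserves.

End Extension.

Lemma seq1_segment i : [:: x i] = segment i i.+1.
Proof. by rewrite -addn1 segmentD. Qed.

Fixpoint line_gens i k :
    lhom (map x (iota i k)) (pairmap (gr_hom line_ecat) i (iota i.+1 k)) :=
  if k is k'.+1
  then (lfmap Q (lcast (seq1_segment i)) ∘ mt_unit Q (x i), line_gens i.+1 k')
  else tt.

Lemma line_gensE i k :
  lheq (line_gens i k) (lunits (mt_unit Q) (map x (iota i k))).
Proof.
elim: k i => [|k IH] i /=; first exact: heq_refl.
by apply: lheq_cons (IH _); apply: heq_lcastl.
Qed.

Lemma iota_monotone i k : path leq i (iota i.+1 k).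
Proof. by elim: k i => //= k IH i; rewrite leqnSn IH. Qed.

Lemma pairmap_segment_iota i k :
  pairmap segment i (iota i.+1 k) = map (fun a => [:: a]) (map x (iota i k)).
Proof. by elim: k i => //= k IH i; rewrite IH -seq1_segment. Qed.

Lemma line_gens_comp i k :
  ec_comp line_ecat i (iota i.+1 k) ∘ lfmap Q (line_gens i k) ≈
  idm (Q (map x (iota i k))).
Proof.
have compE : ec_comp line_ecat i (iota i.+1 k) ≈
    msub Q (map (fun a => [:: a]) (map x (iota i k))).
  by rewrite -pairmap_segment_iota; apply/line_compE/iota_monotone.
apply: heq_trans (heq_comp compE (heq_lfmap Q (line_gensE i k))) _.
by rewrite [_ ∘ _](mt_unitr Q); apply: lfmap_cast_heq.
Qed.

Lemma extension_gens (Y : ECategory Q) (y : nat -> gr_ob Y)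
    (h : forall i, hom (x i) (gr_hom Y (y i) (y i.+1))) i k :
  lheq (lcomp (path_map (extension h) i (iota i.+1 k)) (line_gens i k))
       (lgens h i k).
Proof.
elim: k i => [|k IH] i /=; first exact: heq_refl.
apply: lheq_cons (IH _); rewrite comp_assoc.
have ext1 : extension_hom h i i.+1 ≈
    ec_comp Y (y i) [:: y i.+1] ∘ @lfmap _ _ Q [:: _] [:: _] (h i, tt).
  have shift : extension_hom h i i.+1 ≈ extension_hom h i (i + 1).
    by rewrite addn1; apply: heq_refl.
  exact: heq_trans shift (extension_homE h i 1).
have cast_ext1 := heq_trans (heq_lcastr (seq1_segment i) _) ext1.
apply: heq_trans (heq_comp cast_ext1 (heq_refl (mt_unit Q (x i)))) _.
rewrite -comp_assoc -mt_unit_nat.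
by rewrite comp_assoc ec_unit comp_idl; apply: heq_refl.
Qed.

End FreeLine.

Section FreePathExists.
Variables (A : Category) (Q : Multitensor A) (Q_distr : mt_distributive Q).
Variables (zero : A) (zero_initial : initial zero).

Lemma lgens_shift (Y : ECategory Q) (x x' : nat -> A) (y y' : nat -> gr_ob Y)
    (h : forall i, hom (x i) (gr_hom Y (y i) (y i.+1)))
    (h' : forall i, hom (x' i) (gr_hom Y (y' i) (y' i.+1))) :
  (forall i, x i.+1 = x' i) -> (forall i, y i.+1 = y' i) ->
  (forall i, h i.+1 ≈ h' i) ->
  forall i k, lheq (lgens h i.+1 k) (lgens h' i k).
Proof.
move=> ex ey eh i k; elim: k i => [|k IH] i /=; first exact: heq_refl.
by apply: lheq_cons.
Qed.

Lemma lhom_nth (Y : ECategory Q) (d b : gr_ob Y) (t : seq (gr_ob Y))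
    (xs : seq A) (hs : lhom xs (pairmap (gr_hom Y) b t)) :
  exists h : forall i, hom (nth zero xs i)
                  (gr_hom Y (nth d (b :: t) i) (nth d (b :: t) i.+1)),
    map (nth d (b :: t)) (iota 1 (size xs)) = t /\
    lheq (lgens h 0 (size xs)) hs.
Proof.
elim: xs b t hs => [|x1 xs IH] b [|b' t] //=.
  case.
  have nil_initial i : initial (nth zero [::] i) by rewrite nth_nil.
  exists (fun i => witness (nil_initial i _)).
  by split=> //; apply: heq_refl.
case=> h1 hs; have [h [targetsE hsE]] := IH b' t hs.
exists (fun i => match i return hom (nth zero (x1 :: xs) i)
  (gr_hom Y (nth d [:: b, b' & t] i) (nth d [:: b, b' & t] i.+1)) with
  | 0 => h1 | i'.+1 => h i' end); split.
  by congr cons; rewrite -[in RHS]targetsE (iotaDl 1 1) -map_comp.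
apply: lheq_cons; first exact: heq_refl.
by apply: heq_trans hsE; apply: lgens_shift => // i; apply: heq_refl.
Qed.

Lemma distributive_free_path (xs : seq A) : free_path Q xs.
Proof.
pose x := nth zero xs; pose X := line_ecat Q_distr zero_initial x.
have xsE : xs = map x (iota 0 (size xs)) by rewrite -[LHS](mkseq_nth zero).
pose gens := lcomp (line_gens Q_distr zero_initial x 0 (size xs)) (lcast xsE).
have compE : ec_comp X 0 (iota 1 (size xs)) ∘ lfmap Q gens ≈ idm (Q xs).
  rewrite lfmap_comp comp_assoc; apply: heq_trans (heq_lcastr _ _) _.
  apply: heq_trans (@line_gens_comp _ _ Q_distr _ zero_initial x 0 (size xs)) _.
  by apply: heq_idm; rewrite -xsE.
refine (@FreePath A Q xs X 0 (iota 1 (size xs)) gens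
  (eq_hom (heq_codomain compE)) _ _ _).
- by apply: heq_eq; apply: heq_trans (heq_castl _ _) compE.
- apply: heq_eq; apply: heq_trans (heq_castr _ _) _.
  by apply: heq_trans (compE) _; apply/heq_idm/esym/(heq_codomain compE).
- move=> Y b t hs; have [h [targetsE hsE]] := lhom_nth b hs.
  exists (extension Q_distr zero_initial h); split=> //.
  apply: heq_trans hsE; rewrite lcomp_assoc.
  by apply: heq_trans (heq_castr _ _) _; apply: extension_gens.
Qed.

End FreePathExists.

(** * Uniqueness of lifted multitensors *)

(** A functor from [Q]-categories to [P]-categories over graphs, presented
    without casts between the graphs. *)
Record restriction (A : Category) (P Q : Multitensor A) := Restriction {
  restr_comp :> forall Y : ECategory Q, compositions P Y;
  restr_unital : forall Y, comp_unital (@restr_comp Y);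
  restr_assoc : forall Y, comp_associative (@restr_comp Y);
  restr_preserves : forall (Y Z : ECategory Q) (f : EFunctor Y Z),
    preserves_comp (@restr_comp Y) (@restr_comp Z) f
}.

Arguments restr_comp {A P Q} r Y a s : rename.

Section RestrictionHom.
Variables (A : Category) (P Q : Multitensor A).
Variables (free : forall xs, free_path Q xs) (r : restriction P Q).

Lemma eq_hom_mono (x y z : A) (p : y = z) (f g : hom x y) :
  eq_hom p ∘ f = eq_hom p ∘ g -> f = g.
Proof. by subst z; rewrite !comp_idl. Qed.

Lemma free_path_cancel xs x (f g : hom x (Q xs)) :
  ec_comp (free xs) (fp_source (free xs)) (fp_targets (free xs)) ∘
    lfmap Q (fp_gens (free xs)) ∘ f =
  ec_comp (free xs) (fp_source (free xs)) (fp_targets (free xs)) ∘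
    lfmap Q (fp_gens (free xs)) ∘ g -> f = g.
Proof.
move/(f_equal (compm (fp_inv (free xs)))).
by rewrite !(comp_assoc (fp_inv _) (_ ∘ _)) fp_compK !comp_idl.
Qed.

Lemma restr_map_sig xs : {phi : hom (P xs) (Q xs) |
  forall (Y : ECategory Q) a s (h : lhom xs (pairmap (gr_hom Y) a s)),
    r Y a s ∘ lfmap P h = ec_comp Y a s ∘ lfmap Q h ∘ phi}.
Proof.
exists (fp_inv (free xs) ∘ r (free xs) _ _ ∘ lfmap P (fp_gens (free xs))).
move=> Y a s h.
have [R [src tgt eh]] := fp_extend (free xs) h; subst a s.
rewrite -(lheq_eq eh); apply: (eq_hom_mono (p :=
  f_equal (gr_hom Y (gh_ob R _)) (last_map (gh_ob R) _ (fp_source (free xs))))).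
rewrite !lfmap_comp !comp_assoc -(restr_preserves r R) -(ef_comp R).
rewrite -!comp_assoc (comp_assoc (ec_comp _ _ _)) (comp_assoc _ (fp_inv _)).
by rewrite fp_invK comp_idl.
Qed.

Definition restr_map xs : hom (P xs) (Q xs) := proj1_sig (restr_map_sig xs).

Lemma restr_mapE (Y : ECategory Q) a s xs
    (h : lhom xs (pairmap (gr_hom Y) a s)) :
  r Y a s ∘ lfmap P h = ec_comp Y a s ∘ lfmap Q h ∘ restr_map xs.
Proof. exact: (proj2_sig (restr_map_sig xs)). Qed.

Lemma restr_map_nat xs ys (f : lhom xs ys) :
  restr_map ys ∘ lfmap P f = lfmap Q f ∘ restr_map xs.
Proof.
apply: free_path_cancel; rewrite !comp_assoc -restr_mapE.
by rewrite -comp_assoc -lfmap_comp restr_mapE lfmap_comp comp_assoc.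
Qed.

Lemma restr_map_unit x : restr_map [:: x] ∘ mt_unit P x = mt_unit Q x.
Proof.
apply: free_path_cancel; rewrite comp_assoc -restr_mapE.
case: (free [:: x]) => X a [|b [|c s]] /= gens _ _ _ _;
  [by case: gens | | by case: gens => g []].
case: gens => g []; rewrite -!comp_assoc.
rewrite -[X in _ ∘ X = _]mt_unit_nat -[X in _ = _ ∘ X]mt_unit_nat.
by rewrite !comp_assoc restr_unital ec_unit.
Qed.

Lemma lhom_split (X : Graph A) xs zs a s
    (h : lhom (xs ++ zs) (pairmap (gr_hom X) a s)) :
  exists s1 s2 (f : lhom xs (pairmap (gr_hom X) a s1))
      (g : lhom zs (pairmap (gr_hom X) (last a s1) s2)),
    s = s1 ++ s2 /\ lheq (lcat f g) h.
Proof.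
elim: xs a s h => [|x xs IH] a s h /=.
  by exists [::], s, tt, h; split=> //; apply: heq_refl.
case: s h => [|b s] //= [h hs]; have [s1 [s2 [f [g [sE catE]]]]] := IH _ _ hs.
exists (b :: s1), s2, (h, f), g; split; first by rewrite sE.
by apply: lheq_cons catE; apply: heq_refl.
Qed.

Lemma lhom_splits (X : Graph A) xss a s
    (h : lhom (flatten xss) (pairmap (gr_hom X) a s)) :
  exists ss (hs : @lhom (SeqCat A) xss (paths_homs a ss)),
    s = flatten ss /\ lheq (lflatten hs) h.
Proof.
elim: xss a s h => [|xs xss IH] a s h /=.
  by case: s h => //= -[]; exists [::], tt; split=> //; apply: heq_refl.
have [s1 [s2 [f [g [sE catE]]]]] := lhom_split h.
have [ss [gs [s2E flattenE]]] := IH _ _ g.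
exists (s1 :: ss), (f, gs); split; first by rewrite sE /= s2E.
by apply: heq_trans catE; apply: lheq_cat flattenE; apply: heq_refl.
Qed.

Lemma lcompositions_restr (X : ECategory Q) a ss xss
    (hs : @lhom (SeqCat A) xss (paths_homs a ss)) :
  lcomp (lcompositions (r X) a ss) (lmap P hs) =
  lcomp (lcomp (lcompositions (ec_comp X) a ss) (lmap Q hs))
    (lnats restr_map xss).
Proof.
elim: ss a xss hs => [|s ss IH] a [|xs xss] //= [h hs] /=.
by rewrite IH; congr pair; apply: restr_mapE.
Qed.

Lemma comp_flatten (E : Multitensor A) (X : Graph A) (c : compositions E X) a ss
    xss (hs : @lhom (SeqCat A) xss (paths_homs a ss)) :
  comp_associative c ->
  c a (flatten ss) ∘
    lfmap E (lcomp (lcast (flatten_paths_homs a ss)) (lflatten hs)) ∘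
    msub E xss ≈
  c a (path_targets a ss) ∘ lfmap E (lcomp (lcompositions c a ss) (lmap E hs)).
Proof.
move=> /comp_associativeP cA; rewrite !lfmap_comp !comp_assoc.
rewrite -(comp_assoc _ (lfmap E (lflatten hs))) -msub_nat comp_assoc.
by apply: heq_comp (heq_refl _); apply/heq_sym/cA.
Qed.

Lemma restr_map_sub xss :
  restr_map (flatten xss) ∘ mt_sub P xss =
  mt_sub Q xss ∘ lfmap Q (lnats restr_map xss) ∘ restr_map (map P xss).
Proof.
apply: free_path_cancel; rewrite !comp_assoc -restr_mapE.
case: (free _) => X a s /= gens _ _ _ _.
have [ss [hs [sE flat_hs]]] := lhom_splits gens; subst s.
have -> : gens = lcomp (lcast (flatten_paths_homs a ss)) (lflatten hs).
  by apply: lheq_eq; apply/heq_sym/(heq_trans (heq_castl _ _)).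
apply: heq_eq; apply: heq_trans (comp_flatten hs (restr_assoc r (Y := X))) _.
rewrite lcompositions_restr restr_mapE; apply: heq_comp (heq_refl _).
rewrite lfmap_comp comp_assoc; apply: heq_comp (heq_refl _).
exact: heq_sym (comp_flatten hs (ec_assoc X)).
Qed.

Definition restr_hom : MultitensorHom P Q :=
  @MkMultitensorHom A P Q (@MkNatTrans _ _ P Q restr_map restr_map_nat)
    restr_map_unit restr_map_sub.

End RestrictionHom.

Section CastCategory.
Variables (A : Category) (P : Multitensor A).

Definition cast_comp (Z : ECategory P) (X : Graph A) (e : ec_graph Z = X) :
    compositions P X :=
  eq_rect _ (compositions P) (ec_comp Z) _ e.

Lemma cast_comp_unital (Z : ECategory P) X (e : ec_graph Z = X) :
  comp_unital (cast_comp e).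
Proof. by case: X / e; apply: ec_unit. Qed.

Lemma cast_comp_assoc (Z : ECategory P) X (e : ec_graph Z = X) :
  comp_associative (cast_comp e).
Proof. by case: X / e; apply: ec_assoc. Qed.

Definition cast_ecat (Z : ECategory P) X (e : ec_graph Z = X) : ECategory P :=
  MkECategory (cast_comp_unital e) (cast_comp_assoc e).

Lemma cast_ecatE (Z : ECategory P) X (e : ec_graph Z = X) : cast_ecat e = Z.
Proof. by case: X / e; case: Z => X c u m; apply: ecategory_eq. Qed.

Lemma cast_compE (Y Z : ECategory P) (e : ec_graph Z = ec_graph Y) :
  Z = Y -> cast_comp e = ec_comp Y.
Proof. by move=> ?; subst; rewrite (proof_irrelevance _ e erefl). Qed.

Lemma cast_comp_preserves (Y Z : ECategory P) X X' (e : ec_graph Y = X)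
    (e' : ec_graph Z = X') (R : EFunctor Y Z) (f : GraphHom X X') :
  @heq (GraphCat A) _ _ _ _ (ef_graph R) f ->
  preserves_comp (cast_comp e) (cast_comp e') f.
Proof.
case: X / e f; case: X' / e' => f /(@heq_eq (GraphCat A)) <-; exact: ef_comp.
Qed.

End CastCategory.

Section FunctorRestriction.
Variables (A : Category) (P Q : Multitensor A).
Variable Psi : Functor (ECat Q) (ECat P).
Hypothesis Psi_over : ecat_graph P ⊚ Psi = ecat_graph Q.

Definition graph_over (Y : ECategory Q) : ec_graph (Psi Y) = ec_graph Y :=
  eq_functor_ob (Y : ECat Q) Psi_over.

Lemma cast_functor_preserves (Y Z : ECategory Q) (f : EFunctor Y Z) :
  preserves_comp (cast_comp (graph_over Y)) (cast_comp (graph_over Z)) f.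
Proof.
have over := eq_functor_map (f : @hom (ECat Q) Y Z) Psi_over.
exact: cast_comp_preserves over.
Qed.

Definition functor_restriction : restriction P Q :=
  Restriction (fun Y => cast_comp_unital (graph_over Y))
    (fun Y => cast_comp_assoc (graph_over Y)) cast_functor_preserves.

End FunctorRestriction.

Lemma restr_map_inverse (A : Category) (P Q : Multitensor A)
    (freeP : forall xs, free_path P xs) (freeQ : forall xs, free_path Q xs)
    (Psi : Functor (ECat Q) (ECat P)) (Phi : Functor (ECat P) (ECat Q))
    (Psi_over : ecat_graph P ⊚ Psi = ecat_graph Q)
    (Phi_over : ecat_graph Q ⊚ Phi = ecat_graph P) xs :
  Phi ⊚ Psi = functor_id _ ->
  restr_map freeQ (functor_restriction Psi_over) xs ∘
    restr_map freeP (functor_restriction Phi_over) xs = idm (Q xs).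
Proof.
move=> PhiK; apply: (free_path_cancel (free := freeQ)).
rewrite comp_idr comp_assoc -restr_mapE /=.
pose X := cast_ecat (graph_over Psi_over (freeQ xs)).
have /= <- := restr_mapE freeP (functor_restriction Phi_over) (Y := X)
  (fp_gens (freeQ xs)).
have Phi_X : Phi X = freeQ xs.
  rewrite /X cast_ecatE.
  exact: (eq_functor_ob (fp_cat (freeQ xs) : ECat Q) PhiK).
by rewrite (cast_compE (graph_over Phi_over X) Phi_X).
Qed.

Lemma multitensor_iso_of_ecat_iso (A : Category) (P Q : Multitensor A) :
  (forall xs, free_path P xs) -> (forall xs, free_path Q xs) ->
  (exists Phi : CatIso (ECat P) (ECat Q), ecat_graph Q ⊚ Phi = ecat_graph P) ->
  multitensor_iso P Q.
Proof.
move=> freeP freeQ [[Phi [Psi PsiK PhiK]] /= Phi_over].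
have Psi_over : ecat_graph P ⊚ Psi = ecat_graph Q.
  by rewrite -Phi_over -functor_compA PhiK functor_comp_idr.
exists (restr_hom freeQ (functor_restriction Psi_over)).
exists (restr_hom freeP (functor_restriction Phi_over)) => xs.
by split; apply: restr_map_inverse.
Qed.

Lemma lifted_unique (W : Category) (D : Multitensor W)
    (P Q : Multitensor (EM (mt_monad D))) (zero : EM (mt_monad D)) :
  initial zero -> is_lifted D P -> is_lifted D Q -> multitensor_iso P Q.
Proof.
move=> zero_initial [_ hP [Phi PhiE]] [_ hQ [Psi PsiE]].
apply: multitensor_iso_of_ecat_iso.
- exact: (distributive_free_path hP zero_initial).
- exact: (distributive_free_path hQ zero_initial).
exists (iso_comp (iso_sym Psi) Phi) => /=.
by rewrite -PsiE functor_compA -(functor_compA _ Psi) (Kinverse (iso_inv Psi))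
  functor_comp_idr.
Qed.

Lemma cocontinuous_initial (C D : Category) (G : Functor C D) (x : C) :
  preserves_colimits G -> initial x -> initial (G x).
Proof. by move=> hG; apply: preserves_initial => I; apply: hG. Qed.

Theorem theorem6p6 (V W : Category) (hW : locally_presentable W)
    (U : Functor V W) (F : Functor W V) (adj : Adjunction F U)
    (hmon : monadic adj) (hacc : accessible U) (hcop : preserves_coproducts U)
    (E : Multitensor V) (hclosed : mt_closed E) (hnormal : mt_normal E) :
  (exists D' : Multitensor (EM (mt_monad (UEF adj E))),
     is_lifted (UEF adj E) D') /\
  (forall D' : Multitensor (EM (mt_monad (UEF adj E))),
     is_lifted (UEF adj E) D' ->
     multitensor_iso D' (transport (comparison_iso hmon hnormal) E)).
Proof.
have lifted := transport_lifted hmon hclosed hnormal.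
split=> [|D' lifted']; first by eexists; apply: lifted.
have [w w_initial] := cocomplete_initial hW.1.
have KFw_initial : initial (comparison_iso hmon hnormal (F w)).
  apply: cocontinuous_initial; first exact: iso_cocontinuous.
  apply: cocontinuous_initial w_initial.
  exact: (left_adjoint_cocontinuous adj).
exact: lifted_unique KFw_initial lifted' lifted.
Qed.
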